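(* Let $K$ be a global field, let $S$ be a finite set of primes of $K$ (containing all the archimedean primes if $K$ is an algebraic number field), and let $A$ be the ring of $S$-integers of $K$. Let $k$ and $m$ be arbitrary positive integers. Then in $A$ there is an $m$ term sequence $r_1,r_2,\ldots,r_m$ which is a permutation chain of $k$th power residue modulo $P$ for infinitely many nonzero prime ideals $P$ of $A$.
   Context: A global field is an algebraic number field or an algebraic function field with a finite constant field. The ring of $S$-integers of $K$ is $A=\{a\in K \mid \mathrm{ord}_P(a)\ge 0 \text{ for all primes } P\notin S\}$. $S_m$ denotes the symmetric group on $\{1,\ldots,m\}$. Let $P$ be a nonzero prime ideal of $A$ and $k$ a positive integer. A $k$th power residue modulo $P$ is an element of $A$ that is congruent modulo $P$ to the $k$th power of an element of $A$. A sequence $r_1,r_2,\ldots,r_m$ of elements of $A$ for which the $m(m+1)/2$ sums $\sum_{l=i}^{j} r_l$, $1\le i\le j\le m$, are distinct $k$th power residues modulo $P$ (distinct as residue classes modulo $P$) is called a chain of $k$th power residue modulo $P$. If $r_{\sigma(1)},r_{\sigma(2)},\ldots,r_{\sigma(m)}$ is a chain of $k$th power residue modulo $P$ for all permutations $\sigma\in S_m$, then $r_1,r_2,\ldots,r_m$ is called a permutation chain of $k$th power residue modulo $P$.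
   Formalization: The set S is assumed nonempty when K is a function field; for S empty, A is the finite field of constants, which has no nonzero prime ideals, so the claim fails there. *)

(* Defs.v *)
From HB Require Import structures.
From mathcomp Require Import all_boot all_order all_algebra all_fingroup all_field.
From mathcomp Require Import all_classical all_reals all_analysis.
Set Implicit Arguments.
Unset Strict Implicit.
Unset Printing Implicit Defensive.
Import Order.TTheory GRing.Theory Num.Theory.
Local Open Scope classical_set_scope.
Local Open Scope ring_scope.

(* A number field is a finite extension of Q; a function field with finite
   constant field is a finite extension of F(x), F a finite field. *)
Variant globalField : Type :=
  | NumberField of fieldExtType rat
  | FunctionField (F : finFieldType) of fieldExtType {fraction {poly F}}.

Definition field_of_globalField (K : globalField) : fieldType :=
  match K with NumberField L => L | FunctionField _ L => L end.
Coercion field_of_globalField : globalField >-> fieldType.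

Definition is_number_field (K : globalField) : bool :=
  if K is NumberField _ then true else false.

Definition is_function_field (K : globalField) : bool :=
  if K is FunctionField _ _ then true else false.

(* The nonarchimedean primes P of K, given by their order functions ord_P.
   Each prime has exactly one: ord_P is normalized, i.e. takes the value 1.
   Over a finite constant field, triviality on constants is automatic, since
   nonzero constants are roots of unity. *)
Record finitePrime (K : fieldType) : Type := FinitePrime {
  ordP :> K -> \bar int;
  ordP0 : ordP 0 = +oo%E;
  ordP_fin : forall x, x != 0 -> ordP x \is a fin_num;
  ordPM : forall x y, ordP (x * y) = (ordP x + ordP y)%E;
  ordPD : forall x y, (Order.min (ordP x) (ordP y) <= ordP (x + y))%E;
  ordP_normalized : exists x, ordP x = 1%:E }.

Definition absolute_value (R : realType) (K : fieldType) (v : K -> R) : Prop :=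
  [/\ forall x, 0 <= v x,
      forall x, v x = 0 <-> x = 0,
      forall x y, v (x * y) = v x * v y &
      forall x y, v (x + y) <= v x + v y].

Definition archimedean_absolute_value (R : realType) (K : fieldType)
    (v : K -> R) : Prop :=
  absolute_value v /\ forall B : R, exists n : nat, B < v n%:R.

Definition equivalent_absolute_values (R : realType) (K : fieldType)
    (v w : K -> R) : Prop :=
  exists2 s : R, 0 < s & forall x, w x = v x `^ s.

Record archimedeanPrime (R : realType) (K : fieldType) : Type :=
  ArchimedeanPrime {
    arch_class : set (K -> R);
    arch_classP : exists2 v : K -> R, archimedean_absolute_value v &
      arch_class =
        [set w | absolute_value w /\ equivalent_absolute_values v w] }.

Variant primeOf (R : realType) (K : fieldType) : Type :=
  | Finite of finitePrime K
  | Archimedean of archimedeanPrime R K.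
Arguments Finite R {K}.
Arguments Archimedean {R K}.

Section SIntegers.
Variables (R : realType) (K : fieldType).
Implicit Type S : set (primeOf R K).

Definition Sint S : {pred K} :=
  fun a => `[< forall P : finitePrime K, ~ S (Finite R P) -> (0 <= P a)%E >].

Lemma ordP1 (P : finitePrime K) : P 1 = 0%E.
Proof.
have := ordPM P 1 1; rewrite mulr1.
have := ordP_fin P (oner_neq0 K).
case: (P 1) => // n _ [] /eqP.
by rewrite -subr_eq subrr eq_sym => /eqP ->.
Qed.

Lemma ordPN1 (P : finitePrime K) : P (-1) = 0%E.
Proof.
have := ordPM P (-1) (-1); rewrite mulrNN mulr1 ordP1.
have N1 : (-1 : K) != 0 by rewrite oppr_eq0 oner_neq0.
have := ordP_fin P N1; case: (P (-1)) => // n _ [] /esym /eqP.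
by rewrite -mulr2n mulrn_eq0 /= => /eqP ->.
Qed.

Lemma Sint_subring_closed S : subring_closed (Sint S).
Proof.
split=> [|x y /asboolP xS /asboolP yS|x y /asboolP xS /asboolP yS];
  apply/asboolP => P PS.
- by rewrite ordP1.
- apply: le_trans (ordPD P x (- y)); rewrite le_min xS //=.
  by rewrite -mulN1r ordPM ordPN1 add0e yS.
- by rewrite ordPM adde_ge0 ?xS ?yS.
Qed.

HB.instance Definition _ S :=
  GRing.isSubringClosed.Build K (Sint S) (Sint_subring_closed S).

Record SInteger S : Type :=
  MkSInteger { SInteger_val :> K; _ : SInteger_val \in Sint S }.

HB.instance Definition _ S := [isSub for @SInteger_val S].
HB.instance Definition _ S := [Choice of SInteger S by <:].
HB.instance Definition _ S :=
  [SubChoice_isSubComNzRing of SInteger S by <:].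

End SIntegers.

Section PowerResidueChains.
Variable A : comNzRingType.
Implicit Types (P : {pred A}) (k m : nat).

(* [idealr_closed] includes properness. *)
Definition nonzero_prime_ideal P : Prop :=
  [/\ idealr_closed P, prime_idealr_closed P & exists2 x, x \in P & x != 0].

Definition power_residue k P (a : A) : Prop :=
  exists b : A, a - b ^+ k \in P.

Definition interval_sum m (r : 'I_m -> A) (i j : 'I_m) : A :=
  \sum_(l < m | (i <= l <= j)%N) r l.

Definition residue_chain k m P (r : 'I_m -> A) : Prop :=
  (forall i j : 'I_m, (i <= j)%N -> power_residue k P (interval_sum r i j)) /\
  (forall i j i' j' : 'I_m, (i <= j)%N -> (i' <= j')%N ->
     interval_sum r i j - interval_sum r i' j' \in P -> i = i' /\ j = j').

Definition permutation_residue_chain k m P (r : 'I_m -> A) : Prop :=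
  forall s : 'S_m, residue_chain k P (fun l => r (s l)).

End PowerResidueChains.

(* Main.v *)
Require Import Defs.
From HB Require Import structures.
From mathcomp Require Import all_boot all_order all_algebra all_fingroup all_field.
From mathcomp Require Import cyclic ring zify.
From mathcomp Require Import all_classical all_reals all_analysis.
Set Implicit Arguments.
Unset Strict Implicit.
Unset Printing Implicit Defensive.
Import Order.TTheory GRing.Theory Num.Theory.
Local Open Scope classical_set_scope.
Local Open Scope ring_scope.

(** The arithmetic of power residues plays almost no part.  If x and y lie in the same
    class of the multiplicative group of a finite field modulo kth powers, then
    x^(k-1) y is a kth power.  There are at most k classes, so for a fixed
    element t the classes of the sums of the t^i over i in D, for subsets D of
    a large finite set, form a colouring with k colours.  The finite unions
    theorem (finite_unions) gives disjoint nonempty D_1, ..., D_m all of whose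
    unions have one colour.  Writing X_j for the sum over D_j, every subset sum
    of the r_j = X_1^(k-1) X_j is then a kth power residue.  The sums are
    distinct modulo all but finitely many primes because they are distinct to
    begin with.  A single choice of the D_j serves infinitely many primes, as
    there are only finitely many colourings.  Neither the density of primes nor
    reciprocity enters, only the existence of infinitely many primes P of A
    lying above primes of a subring E, where E is the ring of integers with
    t = 2, or F[t] with t transcendental; see exists_permutation_chain.

    As A is cut out by valuations, its primes are produced by valuations.  Given
    a prime p of E, a subring of K maximal among those that contain E but not
    1/p is a valuation ring by Chevalley's argument, and it is discrete because
    elements of K have bounded degree over E (exists_finitePrime_above).

    In the function field case the element t must have poles only in S, which is
    a consequence of Riemann's theorem; a counting version is proved here
    (exists_one_pole).  Let v0 be in S, z the inverse of a uniformizer at v0, N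
    the degree of K over F(z), q = |F|, and let O1 consist of the elements that
    are integral at the poles of z other than v0.  The combinations of an
    integral basis whose coefficients are polynomials in z of degree at most n
    number q^(N(n+1)).  Their poles have order at most n + C times that of z,
    and modulo O1 such elements fall into at most q^((N-1)(n+C)) classes: one
    dimension out of N is lost at each step, since weak approximation provides
    an element that is a unit at v0 and vanishes to high order at the other
    poles of z (exists_bump).  For large n two combinations are congruent modulo
    O1, and their difference has no pole outside v0. *)

(** * Finite unions *)

(** A standard set of n elements in which the recursion on n exposes one
    element, None, as the largest. *)
Fixpoint iter_option n : finType :=
  if n is n'.+1 then option (iter_option n') : finType else void.

Lemma card_iter_option n : #|iter_option n| = n.
Proof. by elim: n => [|n IH]; rewrite ?card_void //= card_option IH. Qed.

Definition onto (T D : finType) (f : T -> option D) :=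
  forall y, exists x, f x = Some y.

(** A family of disjoint subsets of T indexed by D is encoded by a partial
    function from T to D, the subsets being its fibres; they are nonempty when
    the function is onto.  Unions of members are then preimages, and refining a
    family is composition. *)
Definition blow_up (T D : finType) (f : T -> option D) (I : {set D}) : {set T} :=
  [set x | if f x is Some i then i \in I else false]%SET.

Lemma blow_up_comp (T U D : finType) (f : T -> option U) (g : U -> option D)
    (I : {set D}) :
  blow_up (fun x => obind g (f x)) I = blow_up f (blow_up g I).
Proof.
by apply/setP => x; rewrite !inE; case: (f x) => //= u; rewrite inE.
Qed.

Lemma onto_comp (T U D : finType) (f : T -> option U) (g : U -> option D) :
  onto f -> onto g -> onto (fun x => obind g (f x)).
Proof.
by move=> ft gt y; have [u gu] := gt y; have [x fx] := ft u; exists x; rewrite fx.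
Qed.

(** The fibre over the outer None is the base point of the cube and the other
    fibres are its directions.  For one direction, two of the first #|C|.+1
    initial segments of a chain share a colour.  For one more direction, a set
    Y of new elements is coloured by the whole function sending a subset X of
    the chain to the colour of the union of X and Y; a cube for this colouring
    makes the colour independent of the old directions, uniformly in X. *)
Lemma cube_iter_option n : forall C : finType, exists T : finType,
  forall c : {set T} -> C, exists2 f : T -> option (option (iter_option n)),
    onto f &
    forall I : {set option (iter_option n)},
      None \in I -> c (blow_up f I) = c (blow_up f [set None]%SET).
Proof.
elim: n => [|n IH] C.
  exists unit => c; exists (fun _ => Some None) => [[[]|]|I NI]; first by exists tt.
  by congr c; apply/setP => x; rewrite !inE NI eqxx.
pose T1 : finType := 'I_#|C|.+1.
have [T2 HT2] := IH {ffun {set T1} -> C}.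
exists (T1 + T2)%type => c.
pose join (X : {set T1}) (Y : {set T2}) : {set T1 + T2} :=
  [set z | match z with inl x => x \in X | inr y => y \in Y end]%SET.
have [f2 f2t f2c] := HT2 (fun Y => [ffun X => c (join X Y)]).
pose Y0 := blow_up f2 [set None]%SET.
pose low (a : T1) : {set T1} := [set x : T1 | (x <= a)%N]%SET.
have [a [b [ab cab]]] : exists a b : T1, (a < b)%N /\
    c (join (low a) Y0) = c (join (low b) Y0).
  have /injectivePn[a [b ab cab]] : ~~ injectiveb (fun a => c (join (low a) Y0)).
    apply/negP => /injectiveP inj; have := leq_card _ inj.
    by rewrite card_ord ltnn.
  case: (ltngtP a b) => [lt|lt|/val_inj E]; first by exists a, b.
    by exists b, a.
  by rewrite E eqxx in ab.
(* Elements up to a join the base point; those after a, up to b, form the new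
   direction. *)
pose f (z : T1 + T2) : option (option (iter_option n.+1)) :=
  match z with
  | inl x => if (x <= a)%N then Some None
             else if (x <= b)%N then Some (Some None) else None
  | inr y => omap (omap Some) (f2 y)
  end.
exists f => [[[j|]|]|I NI].
- by have [y fy] := f2t (Some j); exists (inr y); rewrite /= fy.
- by exists (inl b); rewrite /= leqNgt ab leqnn.
- by exists (inl a); rewrite /= leqnn.
have key (J : {set option (iter_option n.+1)}) : None \in J ->
    c (blow_up f J) = c (join (if Some None \in J then low b else low a) Y0).
  move=> NJ; pose J2 := [set o : option (iter_option n) | omap Some o \in J]%SET.
  have NJ2 : None \in J2 by rewrite inE.
  have /ffunP /(_ (if Some None \in J then low b else low a)) := f2c _ NJ2.
  rewrite !ffunE => <-; congr c; apply/setP => -[x|y]; rewrite !inE /=.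
    case: leqP => xa; rewrite ?NJ.
      by case: ifP; rewrite inE ?xa ?(leq_trans xa (ltnW ab)).
    by case: (leqP x b) => xb; case: ifP => iN; rewrite ?inE ?xb ?iN // leqNgt ?xa ?xb.
  by case: (f2 y) => [q|] //=; rewrite inE.
rewrite !key ?inE ?eqxx //=.
by case: ifP => _; rewrite ?cab.
Qed.

Lemma cube (D C : finType) : exists T : finType,
  forall c : {set T} -> C, exists2 f : T -> option (option D),
    onto f &
    forall I : {set option D},
      None \in I -> c (blow_up f I) = c (blow_up f [set None]%SET).
Proof.
have [T HT] := cube_iter_option #|D| C.
have Dn : #|iter_option #|D| | = #|D| by rewrite card_iter_option.
pose e (u : iter_option #|D|) : D := enum_val (cast_ord Dn (enum_rank u)).
pose g (o : option (iter_option #|D|)) := Some (omap e o).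
have gt : onto g.
  move=> [y|]; last by exists None.
  exists (Some (enum_val (cast_ord (esym Dn) (enum_rank y)))).
  by rewrite /g /e /= enum_valK cast_ordKV enum_rankK.
exists T => c; have [f ft fc] := HT c.
exists (fun x => obind g (f x)); first exact: onto_comp.
have gN (J : {set option D}) : None \in J -> None \in blow_up g J by rewrite inE.
by move=> I NI; rewrite !blow_up_comp (fc _ (gN _ NI)) [RHS]fc // gN // inE.
Qed.

(** Unfolded along the enumeration of iter_option n, this says that the value of
    a nonempty set depends only on its largest element. *)
Fixpoint leading (C : Type) n : ({set iter_option n} -> C) -> Prop :=
  if n is n'.+1 then fun phi =>
    (forall I : {set option (iter_option n')}, None \in I -> phi I = phi [set None]%SET)
    /\ leading (fun J : {set iter_option n'} => phi (Some @: J)%SET)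
  else fun _ => True.

(** A cube is taken with as many directions as the theorem for n needs
    elements.  Its base point becomes the largest of the new sets, and the
    others are found among the directions; a union that contains the base point
    has the colour of the base point by the choice of the cube. *)
Lemma leading_coloring (C : finType) n : exists T : finType,
  forall c : {set T} -> C, exists2 f : T -> option (iter_option n),
    onto f & leading (fun I => c (blow_up f I)).
Proof.
elim: n => [|n [T' HT']].
  by exists void => c; exists (fun=> None) => [[]|].
have [T HT] := cube T' C; exists T => c; have [g gt gc] := HT c.
have [f' ft' fc'] := HT' (fun I => c (blow_up g (Some @: I)%SET)).
pose h (o : option T') := if o is Some t then omap Some (f' t) else Some None.
have ht : onto h.
  move=> [j|]; last by exists None.
  by have [t ft] := ft' j; exists (Some t); rewrite /= ft.
exists (fun x => obind h (g x)); first exact: onto_comp.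
have hN (J : {set option (iter_option n)}) : None \in J -> None \in blow_up h J.
  by rewrite inE.
split=> [I NI|]; first by rewrite !blow_up_comp (gc _ (hN _ NI)) [RHS]gc // hN // inE.
congr leading: fc'; apply/funext => J; rewrite blow_up_comp; congr (c (blow_up g _)).
apply/setP => -[t|]; rewrite !inE /=; last by apply/imsetP/imsetP => -[].
rewrite mem_imset; last exact: Some_inj.
by rewrite inE; case: (f' t) => //= j; rewrite mem_imset; last exact: Some_inj.
Qed.

Lemma leading_mono (C : Type) n (phi : {set iter_option n} -> C) (k : C)
    (I : {set iter_option n}) :
  leading phi -> I != finset.set0 -> (forall i, i \in I -> phi [set i]%SET = k) ->
  phi I = k.
Proof.
elim: n phi I => [|n IH] phi I /=.
  by move=> _ /finset.set0Pn[[]].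
move=> [phiN phiS] I0 kI.
have [NI|NI] := boolP (None \in I); first by rewrite phiN // kI.
pose J := [set j | Some j \in I]%SET.
have IJ : I = (Some @: J)%SET.
  apply/setP => -[j|]; first by rewrite mem_imset ?inE //; exact: Some_inj.
  by rewrite (negbTE NI); apply/esym/imsetP => -[].
rewrite IJ (IH (fun J : {set iter_option n} => phi (Some @: J)%SET)) //.
  case/finset.set0Pn: I0 => -[j|] jI; last by rewrite jI in NI.
  by apply/finset.set0Pn; exists j; rewrite inE.
by move=> j; rewrite inE => /kI; rewrite imset_set1.
Qed.

(** The finite unions theorem of Folkman, Rado and Sanders: when the colour of
    a union depends only on its largest member, it suffices to keep m members
    of the same colour. *)
Lemma finite_unions (C : finType) m : exists T : finType,
  forall c : {set T} -> C, exists2 f : T -> option 'I_m,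
    onto f & exists k, forall I : {set 'I_m}, I != finset.set0 -> c (blow_up f I) = k.
Proof.
have [T HT] := leading_coloring C (#|C| * m).+1; exists T => c.
set U := iter_option _ in HT; have [g gt gc] := HT c.
pose col (u : U) := c (blow_up g [set u]%SET).
have [k km] : exists k, (m <= #|[set u | col u == k]%SET|)%N.
  apply/existsP; apply: contraT; rewrite negb_exists => /forallP small.
  have : (#|U| <= \sum_(k : C) m)%N.
    rewrite -sum1_card (partition_big col xpredT) //= leq_sum // => k _.
    have := small k; rewrite -ltnNge => /ltnW; rewrite -sum1_card.
    by rewrite (eq_bigl (fun u => col u == k)) // => u; rewrite inE.
  by rewrite sum_nat_const card_iter_option ltnn.
pose e (i : 'I_m) : U := enum_val (widen_ord km i).
have ei : injective e.
  by move=> i j /enum_val_inj /(congr1 val) /= /val_inj.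
pose h u := [pick i | e i == u].
have he i : h (e i) = Some i.
  rewrite /h; case: pickP => [j /eqP /ei -> //|/(_ i)]; by rewrite eqxx.
exists (fun x => obind h (g x)).
  by apply: onto_comp => // i; exists (e i).
exists k => I I0; rewrite blow_up_comp (leading_mono (k := k) gc) //.
  by case/finset.set0Pn: I0 => i iI; apply/finset.set0Pn; exists (e i); rewrite inE he.
move=> u; rewrite inE /h; case: pickP => // i /eqP <- _.
by have := enum_valP (widen_ord km i); rewrite inE => /eqP.
Qed.

(** * Power classes in a finite field *)

Lemma finField_generator (L : finFieldType) :
  exists g : L, forall a, a != 0 -> exists i, a = g ^+ i.
Proof.
have /cyclicP[u uP] := field_unit_group_cyclic [set: {unit L}]%G.
exists (val u) => a a0; have ua : a \is a GRing.unit by rewrite unitfE.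
have : FinRing.unit L ua \in <[u]>%g by rewrite -uP inE.
by case/cycleP => i /(congr1 val) /= ->; exists i; rewrite FinRing.val_unitX.
Qed.

(** The colour is the discrete logarithm modulo k+1.  If it agrees at a and b,
    the logarithm of a^k b is a multiple of k+1. *)
Lemma power_class (L : finFieldType) k : exists chi : L -> 'I_k.+1,
  forall a b, chi a = chi b -> exists c, a ^+ k * b = c ^+ k.+1.
Proof.
have [g gP] := finField_generator L.
pose log a := xget 0%N [set i | a = g ^+ i].
have logP a : a != 0 -> a = g ^+ log a.
  by move=> /gP[i ai]; exact: (@xgetI _ 0%N [set i | a = g ^+ i] i ai).
exists (fun a => inord (log a %% k.+1)) => a b.
move=> /(congr1 val); rewrite /= !inordK ?ltn_mod // => /eqP ab.
have [->|b0] := eqVneq b 0; first by exists 0; rewrite mulr0 expr0n.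
have [->|a0] := eqVneq a 0.
  by case: k {ab} => [|k]; [exists b; rewrite expr0 mul1r expr1
                        |exists 0; rewrite !expr0n mul0r].
have dvd : (k.+1 %| k * log a + log b)%N.
  by rewrite /dvdn -modnDmr -(eqP ab) modnDmr addnC -mulSn modnMr.
exists (g ^+ ((k * log a + log b) %/ k.+1)); rewrite -exprM divnK //.
by rewrite exprD mulnC exprM -!logP.
Qed.

(** * Discrete valuations above a prime *)

(** A nontrivial valuation with integer values is normalized by dividing by the
    positive generator of its group of values. *)
Lemma finitePrime_of_int (K : fieldType) (w : K -> int) :
  (forall x y : K, x != 0 -> y != 0 -> w (x * y) = w x + w y) ->
  (forall x y : K, x != 0 -> y != 0 -> x + y != 0 -> Order.min (w x) (w y) <= w (x + y)) ->
  (exists2 x : K, x != 0 & w x != 0) ->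
  exists v : finitePrime K, exists2 g : int, 0 < g &
    forall x, x != 0 -> exists2 n : int, v x = n%:E & w x = n * g.
Proof.
move=> wM wD [x0 x00 wx0].
have w1 : w 1 = 0.
  by apply: (addrI (w 1)); rewrite addr0 -wM ?oner_neq0 // mulr1.
have wV (x : K) : x != 0 -> w x^-1 = - w x.
  by move=> x_n0; apply/eqP; rewrite -addr_eq0 addrC -wM ?invr_eq0 // divff // w1.
have wX (x : K) (n : nat) : x != 0 -> w (x ^+ n) = n%:Z * w x.
  move=> x_n0; elim: n => [|n IH]; first by rewrite expr0 w1 mul0r.
  by rewrite exprS wM ?expf_neq0 // IH intS mulrDl mul1r.
have wXz (x : K) (n : int) : x != 0 -> w (x ^ n) = n * w x.
  by move=> x_n0; case: n => n; rewrite ?NegzE /exprz ?wX // wV ?expf_neq0 // wX // mulNr.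
have exg : exists n : nat, `[< exists2 x : K, x != 0 & w x = n.+1%:Z >].
  have [lt|ge] := ltP 0 (w x0).
    by exists `|w x0|.-1%N; apply/asboolP; exists x0; rewrite // prednK ?absz_gt0 // gtz0_abs.
  exists `|w x0|.-1%N; apply/asboolP; exists x0^-1; rewrite ?invr_eq0 // wV //.
  by rewrite prednK ?absz_gt0 // lez0_abs.
case: (ex_minnP exg) => g /asboolP[y y0 wy] gmin.
have g0 : (0 : int) < g.+1 by [].
have dvdg (x : K) : x != 0 -> (g.+1 %| w x)%Z.
  move=> x_n0; apply/dvdz_mod0P; apply/eqP; apply: contraT => r0.
  pose r := (w x %% g.+1)%Z; have r_ge0 : 0 <= r by rewrite modz_ge0.
  have r_lt : r < g.+1 by rewrite ltz_mod.
  have : (g <= `|r|.-1)%N.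
    apply: gmin; apply/asboolP; exists (x * y ^ (- (w x %/ g.+1)%Z)).
      by rewrite mulf_neq0 // expfz_neq0.
    rewrite wM ?expfz_neq0 // wXz // wy prednK ?absz_gt0 // gez0_abs // /r.
    by rewrite {1}(divz_eq (w x) g.+1) mulNr addrAC subrr add0r.
  have : (0 < `|r|)%N by rewrite absz_gt0.
  move: r_lt; rewrite -{1}(gez0_abs r_ge0) ltz_nat.
  by case: `|r|%N => // r'; rewrite ltnS ltnNge /= => /negbTE ->.
pose o (x : K) : \bar int := if x == 0 then +oo%E else ((w x %/ g.+1)%Z)%:E.
have o0 : o 0 = +oo%E by rewrite /o eqxx.
have oE (x : K) : x != 0 -> o x = ((w x %/ g.+1)%Z)%:E by rewrite /o => /negbTE ->.
have o_fin (x : K) : x != 0 -> o x \is a fin_num by move=> /oE ->.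
have oM (x y' : K) : o (x * y') = (o x + o y')%E.
  have [->|x_n0] := eqVneq x 0.
    by rewrite mul0r o0; case: (eqVneq y' 0) => [->|/oE ->]; rewrite ?o0.
  have [->|y_n0] := eqVneq y' 0; first by rewrite mulr0 o0 oE.
  by rewrite !oE ?mulf_neq0 // wM // divzDl ?dvdg.
have oD (x y' : K) : (Order.min (o x) (o y') <= o (x + y')%R)%E.
  have [->|x_n0] := eqVneq x 0; first by rewrite add0r ge_min lexx orbT.
  have [->|y_n0] := eqVneq y' 0; first by rewrite addr0 ge_min lexx.
  have [->|xy_n0] := eqVneq (x + y') 0; first by rewrite o0 leey.
  rewrite !oE // -EFin_min lee_fin.
  by have := wD _ _ x_n0 y_n0 xy_n0; rewrite !ge_min !(lez_divRL) // !divzK ?dvdg.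
have o_norm : exists x, o x = 1%:E.
  by exists y; rewrite oE // wy divzz.
exists (FinitePrime o0 o_fin oM oD o_norm), g.+1%:Z => // x x_n0 /=.
by exists (w x %/ g.+1)%Z; rewrite ?oE // divzK ?dvdg.
Qed.

Section Valuation_ring.
Variables (K : fieldType) (R : subringClosed K) (q : K).
Hypotheses (Rq : q \in R) (Rq' : q^-1 \notin R).

Lemma uniformizer_neq0 : q != 0.
Proof. by apply: contraNneq Rq' => ->; rewrite invr0 rpred0. Qed.

Definition R_unit x := [&& x != 0, x \in R & x^-1 \in R].

Lemma R_unitM x y : R_unit x -> R_unit y -> R_unit (x * y).
Proof.
move=> /and3P[x0 xR xR'] /and3P[y0 yR yR'].
by rewrite /R_unit mulf_neq0 // invfM !rpredM.
Qed.

Lemma R_unitV x : R_unit x -> R_unit x^-1.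
Proof. by rewrite /R_unit invr_eq0 invrK => /and3P[-> -> ->]. Qed.

Lemma R_unitX x n : R_unit x -> R_unit (x ^+ n).
Proof.
move=> xU; elim: n => [|n IH]; last by rewrite exprS R_unitM.
by rewrite expr0 /R_unit oner_neq0 invr1 rpred1.
Qed.

(** Otherwise q would be invertible in R. *)
Lemma expz_unit_ge0 (n : int) x : x \in R -> R_unit (x * q ^ (- n)) -> 0 <= n.
Proof.
move=> xR; case: n => // n; rewrite NegzE opprK => /and3P[x0 _ yR].
case/negP: Rq'.
have -> : q^-1 = x * q ^+ n * (x * q ^ n.+1)^-1.
  have q0 := uniformizer_neq0.
  have x_n0 : x != 0 by apply: contraNneq x0 => ->; rewrite mul0r.
  rewrite -exprnP invfM exprS invfM mulrACA divff // mul1r mulrCA.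
  by rewrite divff ?expf_neq0 // mulr1.
by rewrite !(rpredM, rpredX).
Qed.

Hypothesis R_total : forall x, x \in R \/ x^-1 \in R.
Variable e : nat.
Hypothesis e_gt0 : (0 < e)%N.
Hypothesis Re : forall x, x != 0 -> exists n : int, R_unit (x ^+ e * q ^ (- n)).

(** The order of x is the exponent n for which x^e and q^n differ by a unit,
    divided by a constant.  The fixed power e makes such an n exist. *)
Lemma valuation_ring_finitePrime : exists v : finitePrime K,
  (forall x, x \in R -> (0 <= v x)%E) /\ (0 < v q)%E.
Proof.
have q0 := uniformizer_neq0.
pose w x : int := xget 0 [set n : int | R_unit (x ^+ e * q ^ (- n))].
have wP x : x != 0 -> R_unit (x ^+ e * q ^ (- w x)).
  move=> /Re[n xn].
  exact: (@xgetI _ 0 [set n : int | R_unit (x ^+ e * q ^ (- n))] n xn).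
have wR x : x != 0 -> x \in R -> 0 <= w x.
  by move=> x0 xR; apply: expz_unit_ge0 (wP x x0); rewrite rpredX.
have w_uniq x n : x != 0 -> R_unit (x ^+ e * q ^ (- n)) -> w x = n.
  move=> x0 xn.
  have key a b : R_unit (x ^+ e * q ^ (- a)) -> R_unit (x ^+ e * q ^ (- b)) -> a <= b.
    move=> xa xb; rewrite -subr_ge0; apply: (expz_unit_ge0 (rpred1 R)).
    have -> : 1 * q ^ (- (b - a)) = (x ^+ e * q ^ (- b)) * (x ^+ e * q ^ (- a))^-1.
      rewrite mul1r invfM mulrACA divff ?expf_neq0 // mul1r invr_expz opprK opprB.
      by rewrite expfzDr // mulrC.
    by rewrite R_unitM ?R_unitV.
  by apply/eqP; rewrite eq_le !key // wP.
have wM x y : x != 0 -> y != 0 -> w (x * y) = w x + w y.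
  move=> x0 y0; apply: w_uniq; first by rewrite mulf_neq0.
  by rewrite exprMn opprD expfzDr // mulrACA R_unitM ?wP.
have w_div x y : x != 0 -> y != 0 -> x / y \in R -> w y <= w x.
  move=> x0 y0 xyR; rewrite -(divfK y0 x) wM ?mulf_neq0 ?invr_eq0 //.
  by rewrite lerDr wR // mulf_neq0 ?invr_eq0.
have wD x y : x != 0 -> y != 0 -> x + y != 0 -> Order.min (w x) (w y) <= w (x + y).
  move=> x0 y0 xy0; rewrite ge_min.
  have [xyR|yxR] := R_total (x / y).
    by rewrite orbC w_div // mulrDl divff // rpredD ?rpred1.
  by rewrite w_div // mulrDl divff // rpredD ?rpred1 // -invf_div.
have wq : w q = e%:Z.
  apply: w_uniq => //; rewrite -exprnN divff ?expf_neq0 //.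
  by rewrite /R_unit oner_neq0 invr1 rpred1.
have [|v [g g0 vg]] := finitePrime_of_int wM wD.
  by exists q; rewrite // wq; case: e e_gt0.
exists v; split=> [x xR|].
  have [->|x0] := eqVneq x 0; first by rewrite ordP0.
  have [n -> wn] := vg x x0; rewrite lee_fin.
  by have := wR x x0 xR; rewrite wn pmulr_lge0.
have [n -> wn] := vg q q0; rewrite lte_fin -(pmulr_lgt0 _ g0) -wn wq.
by case: e e_gt0.
Qed.

End Valuation_ring.

Section Maximal_subring.
Variables (K : fieldType) (R : subringClosed K) (q : K).
Hypotheses (Rq : q \in R) (Rq' : q^-1 \notin R).
Hypothesis R_max : forall z, z \notin R ->
  exists2 f : {poly K}, f \is a polyOver R & f.[z] = q^-1.

Let q0 : q != 0 := uniformizer_neq0 Rq'.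

Lemma exp_subMq b n : b \in R -> exists2 s, s \in R & (1 - q * b) ^+ n = 1 - q * s.
Proof.
move=> bR; elim: n => [|n [s sR sE]].
  by exists 0; rewrite ?rpred0 // mulr0 subr0 expr0.
exists (b + s - q * b * s); first by rewrite !(rpredB, rpredD, rpredM).
by rewrite exprS sE; ring.
Qed.

(** If u = 1 - q b were not invertible in R, then 1/q would be a polynomial in
    1/u by maximality; multiplying by a power of u, which is 1 modulo q, would
    put 1/q in R. *)
Lemma inv_subMq b : b \in R -> (1 - q * b)^-1 \in R.
Proof.
move=> bR; apply: contraT => uR; have [f fR fu] := R_max uR.
set u := 1 - q * b in uR fu *.
have u0 : u != 0 by apply: contraNneq uR => ->; rewrite invr0 rpred0.
have uR1 : u \in R by rewrite !(rpredB, rpredM) ?rpred1.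
have [s sR sE] := exp_subMq (size f) bR; rewrite -/u in sE.
case/negP: Rq'.
have -> : q^-1 = u ^+ size f * f.[u^-1] + s.
  by rewrite fu sE mulrBl mul1r mulrAC mulfV // mul1r subrK.
rewrite rpredD // horner_coef mulr_sumr rpred_sum // => i _.
rewrite mulrCA rpredM ?(polyOverP fR) // exprVn -expfB //.
by rewrite rpredX.
Qed.

(** If neither z nor 1/z lies in R, then 1/q is a polynomial f in z and a
    polynomial g in 1/z.  Say that g has the smaller degree bound.  As
    1 - q g(0) is invertible, the second relation expresses z^(n+1) through
    lower powers of z, and so lowers the degree of f. *)
Lemma maximal_subring_total_aux N : forall n m z (f g : {poly K}), (n + m <= N)%N ->
  (size f <= n.+1)%N -> (size g <= m.+1)%N ->
  f \is a polyOver R -> g \is a polyOver R ->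
  f.[z] = q^-1 -> g.[z^-1] = q^-1 -> False.
Proof.
elim: N => [|N IH] n m z f g.
  rewrite leqn0 addn_eq0 => /andP[/eqP -> _] /size1_polyC sf _ fR _ fz _.
  by case/negP: Rq'; rewrite -fz sf hornerC (polyOverP fR).
wlog mn : n m z f g / (m <= n)%N.
  move=> W nmN sf sg fR gR fz gz; have [mn|/ltnW nm] := leqP m n; first exact: (W n m z f g).
  by apply: (W m n z^-1 g f); rewrite ?invrK // addnC.
move=> nmN sf sg fR gR fz gz.
have z0 : z != 0.
  apply: contraTneq (Rq') => z0; move: fz; rewrite z0 horner_coef0 => <-.
  by rewrite negbK (polyOverP fR).
case: n => [|n] in mn nmN sf *.
  by case/negP: Rq'; rewrite -fz (size1_polyC sf) hornerC (polyOverP fR).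
pose u := 1 - q * g`_0; have uR : u^-1 \in R by rewrite inv_subMq ?(polyOverP gR).
have u0 : u != 0.
  apply: contraNneq Rq' => /eqP; rewrite subr_eq0 => /eqP E.
  by rewrite -[q^-1]mulr1 E mulKf // (polyOverP gR).
pose h := (q / u) *: \sum_(j < m) g`_j.+1 *: 'X^(n - j).
have hz : h.[z] = z ^+ n.+1.
  rewrite hornerZ horner_sum.
  have -> : \sum_(j < m) (g`_j.+1 *: 'X^(n - j)).[z] = z ^+ n.+1 * (g.[z^-1] - g`_0).
    rewrite (horner_coef_wide _ sg) big_ord_recl expr0 mulr1 addrC addrA addNr add0r.
    rewrite mulr_sumr; apply: eq_bigr => j _; rewrite hornerZ hornerXn mulrCA.
    have jn : (j <= n)%N by rewrite -ltnS (leq_trans (ltn_ord j)).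
    by rewrite exprVn -expfB_cond ?(negbTE z0) // subSS.
  rewrite gz; have -> : q^-1 - g`_0 = u / q by rewrite mulrBl mul1r mulrAC divff // mul1r.
  by rewrite mulrCA [q / u * _]mulrA divfK // divff // mulr1.
have hR : h \is a polyOver R.
  rewrite polyOverZ ?rpredM // rpred_sum // => j _.
  by rewrite polyOverZ ?(polyOverP gR) // rpredX // polyOverX.
have sh : (size h <= n.+1)%N.
  apply: leq_trans (size_scale_leq _ _) _.
  apply: leq_trans (size_sum _ _ _) _; apply/bigmax_leqP => j _.
  by apply: leq_trans (size_scale_leq _ _) _; rewrite size_polyXn ltnS leq_subr.
apply: (IH n m z (\poly_(i < n.+1) f`_i + f`_n.+1 *: h) g) => //.
- rewrite (leq_trans (size_polyD _ _)) // geq_max size_poly /=.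
  exact: leq_trans (size_scale_leq _ _) _.
- rewrite rpredD //; last by rewrite -mul_polyC rpredM // polyOverC (polyOverP fR).
  by apply/polyOverP => i; rewrite coef_poly; case: ifP => _; rewrite ?rpred0 ?(polyOverP fR).
- by rewrite hornerD horner_poly hornerZ hz -fz (horner_coef_wide _ sf) [RHS]big_ord_recr.
Qed.

Lemma maximal_subring_total z : z \in R \/ z^-1 \in R.
Proof.
have [|zR] := boolP (z \in R); [by left | right; apply: contraT => zR'].
have [f fR fz] := R_max zR; have [g gR gz] := R_max zR'.
by case: (@maximal_subring_total_aux (size f + size g) (size f) (size g) z f g).
Qed.

End Maximal_subring.

(** Zorn's lemma; maximality is used through the ring generated by one more
    element. *)
Lemma exists_maximal_subring (K : fieldType) (A : set K) (q : K) :
  A 1 -> (forall x y, A x -> A y -> A (x - y)) ->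
  (forall x y, A x -> A y -> A (x * y)) -> ~ A q^-1 ->
  exists R : subringClosed K, [/\ forall x, A x -> x \in R, q^-1 \notin R &
    forall z, z \notin R -> exists2 f : {poly K}, f \is a polyOver R & f.[z] = q^-1].
Proof.
move=> A1 AB AM Aq.
pose ring (X : set K) := [/\ A `<=` X, forall x y, X x -> X y -> X (x - y),
  forall x y, X x -> X y -> X (x * y) & ~ X q^-1].
(* The empty set is added because the union of an empty chain must be covered. *)
have [F FP Fchain|X [[X0|[AX XB XM Xq]] Xmax]] := @Zorn_bigcup K (fun X => X = set0 \/ ring X).
- have [allF|] := pselect (forall X, F X -> X = set0).
    left; apply/seteqP; split=> x // -[X FX]; by rewrite (allF _ FX).
  move=> /existsNP[X0 /not_implyP[FX0 X00]]; right.
  have FR X x : F X -> X x -> ring X.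
    by move=> FX Xx; case: (FP _ FX) => // X_0; rewrite X_0 in Xx.
  have [AX0 _ _ _] : ring X0 by case: (FP _ FX0).
  have two x y : (\bigcup_(X in F) X) x -> (\bigcup_(X in F) X) y ->
      exists X, [/\ F X, X x & X y].
    move=> [X FX Xx] [Y FY Yy]; have [XY|YX] := Fchain _ _ FX FY.
      by exists Y; split=> //; exact: XY.
    by exists X; split=> //; exact: YX.
  split=> [x Ax|x y Ux Uy|x y Ux Uy|[X FX Xq]].
  + by exists X0; last exact: AX0.
  + have [X [FX Xx Xy]] := two _ _ Ux Uy; exists X => //.
    by have [_ XB _ _] := FR _ _ FX Xx; exact: XB.
  + have [X [FX Xx Xy]] := two _ _ Ux Uy; exists X => //.
    by have [_ _ XM _] := FR _ _ FX Xx; exact: XM.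
  + by have [_ _ _] := FR _ _ FX Xq; apply.
- case: (Xmax A); last by right; split.
  by rewrite X0; split=> // /(_ _ A1).
pose S : {pred K} := fun x => `[< X x >].
have SP x : (x \in S) = `[< X x >] by [].
have Sring : subring_closed S.
  split=> [|x y /asboolP xX /asboolP yX|x y /asboolP xX /asboolP yX]; apply/asboolP.
  - exact: AX.
  - exact: XB.
  - exact: XM.
pose R : subringClosed K := HB.pack S (GRing.isSubringClosed.Build K S Sring).
have RP x : (x \in R) = `[< X x >] by [].
exists R; split=> [x /AX Xx|| z zR].
- by rewrite RP; apply/asboolP.
- by rewrite RP; apply/asboolP.
pose Xz := [set x | exists2 f : {poly K}, f \is a polyOver R & f.[z] = x].
apply: contrapT => noz; apply: (Xmax Xz).
  split=> [x Xx|Xzz].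
    exists x%:P; rewrite ?hornerC // polyOverC RP; exact/asboolP.
  move: zR; rewrite RP => /asboolP; apply; apply: (Xzz z).
  by exists 'X; rewrite ?polyOverX ?hornerX.
right; split=> [x Ax|x y [f fR <-] [g gR <-]|x y [f fR <-] [g gR <-]|//].
- exists x%:P; rewrite ?hornerC // polyOverC RP; apply/asboolP; exact: AX.
- by exists (f - g); rewrite ?rpredB // hornerD hornerN.
- by exists (f * g); rewrite ?rpredM // hornerM.
Qed.

Section Root_exponent.
Variables (K : fieldType) (R : subringClosed K) (q : K).
Hypothesis R_total : forall x, x \in R \/ x^-1 \in R.

Let nonunit x := x \in R /\ (x != 0 -> x^-1 \notin R).

Let nonunitD x y : nonunit x -> nonunit y -> nonunit (x + y).
Proof.
move=> [xR xR'] [yR yR'].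
have [-> |x0] := eqVneq x 0; first by rewrite add0r.
have [-> |y0] := eqVneq y 0; first by rewrite addr0.
split; first by rewrite rpredD.
move=> xy0; apply/negP => xyR.
have [h|h] := R_total (x / y).
  case/negP: (yR' y0); have -> : y^-1 = (x / y + 1) * (x + y)^-1.
    by rewrite -[1](divff y0) -mulrDl mulrAC divff // mul1r.
  by rewrite rpredM // rpredD ?rpred1.
case/negP: (xR' x0); have -> : x^-1 = ((x / y)^-1 + 1) * (x + y)^-1.
  by rewrite invf_div -[1](divff x0) -mulrDl [y + x]addrC mulrAC divff // mul1r.
by rewrite rpredM // rpredD ?rpred1.
Qed.

Let minimal_term (I : eqType) (T : I -> K) (s : seq I) : s != [::] ->
  (forall i, i \in s -> T i != 0) ->
  exists2 i, i \in s & forall j, j \in s -> T j / T i \in R.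
Proof.
elim: s => // i s IH _ T0.
have Ti : T i != 0 by rewrite T0 ?mem_head.
have [->|sn0] := eqVneq s [::].
  by exists i; rewrite ?mem_head // => j; rewrite inE => /eqP ->; rewrite divff ?rpred1.
have [|j js jmin] := IH sn0; first by move=> j js; rewrite T0 // inE js orbT.
have Tj : T j != 0 by rewrite T0 // inE js orbT.
have [h|h] := R_total (T i / T j).
  exists j; first by rewrite inE js orbT.
  by move=> l; rewrite inE => /predU1P[-> //|]; exact: jmin.
exists i; first by rewrite mem_head.
move=> l; rewrite inE => /predU1P[->|ls]; first by rewrite divff ?rpred1.
have -> : T l / T i = T l / T j * (T i / T j)^-1.
  by rewrite invf_div mulrA divfK.
by rewrite rpredM // jmin.
Qed.

(** In an equation P(x) = 0 the terms of smallest order cannot occur alone, so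
    two terms have the same order.  Comparing them yields the order of a power
    of x in terms of the orders of the coefficients, which are powers of q up
    to units. *)
Lemma root_exponent (P : {poly K}) x : q != 0 -> x != 0 -> P != 0 -> root P x ->
  (forall i, P`_i != 0 -> exists n : int, R_unit R (P`_i * q ^ n)) ->
  exists d (n : int), [/\ (0 < d)%N, (d < size P)%N & R_unit R (x ^+ d * q ^ n)].
Proof.
move=> q0 x0 P0 /rootP Px Pu.
pose s := [seq i <- iota 0 (size P) | P`_i != 0].
have sP i : i \in s = (P`_i != 0).
  rewrite mem_filter mem_iota /= add0n; case: (ltnP i (size P)) => [_|h]; first by rewrite andbT.
  by rewrite nth_default // eqxx.
pose T i := P`_i * x ^+ i.
have T0 i : i \in s -> T i != 0 by rewrite sP => Pi; rewrite mulf_neq0 // expf_neq0.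
have sn0 : s != [::].
  have : (size P).-1 \in s by rewrite sP -/(lead_coef P) lead_coef_eq0.
  by apply: contraTneq => ->; rewrite in_nil.
have [i is_ imin] := minimal_term sn0 T0.
have [j [js ji ijR]] : exists j, [/\ j \in s, j != i & T i / T j \in R].
  apply: contrapT => none.
  have i_lt : (i < size P)%N.
    by rewrite ltnNge; move: is_; rewrite sP; apply: contra => /leq_sizeP ->.
  have : nonunit (\sum_(j < size P | j != Ordinal i_lt) T j / T i).
    apply: (big_ind nonunit) => [||j ji]; first by split; rewrite ?rpred0 ?eqxx.
      exact: nonunitD.
    have [Pj|Pj] := eqVneq P`_j 0.
      by rewrite /T Pj !mul0r; split; rewrite ?rpred0 ?eqxx.
    have js : (j : nat) \in s by rewrite sP.
    split=> [|_]; first exact: imin.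
    rewrite invf_div; apply/negP => ijR; apply: none; exists (val j); split=> //.
  have -> : \sum_(j < size P | j != Ordinal i_lt) T j / T i = -1.
    have : \sum_(j < size P) T j / T i = 0 by rewrite -mulr_suml -horner_coef Px mul0r.
    by rewrite (bigD1 (Ordinal i_lt)) //= divff ?T0 // => /eqP; rewrite addrC addr_eq0 => /eqP.
  by case=> _ /(_ _)/negP[]; rewrite ?oppr_eq0 ?oner_neq0 // invrN invr1 rpredN rpred1.
have U : R_unit R (T i / T j).
  by rewrite /R_unit mulf_neq0 ?invr_eq0 ?T0 // ijR invf_div imin.
have gap k l : k \in s -> l \in s -> (k < l)%N -> R_unit R (T l / T k) ->
    exists d (n : int), [/\ (0 < d)%N, (d < size P)%N & R_unit R (x ^+ d * q ^ n)].
  move=> ks ls kl Ukl.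
  have [a Ua] := Pu k (etrans (esym (sP k)) ks); have [b Ub] := Pu l (etrans (esym (sP l)) ls).
  exists (l - k)%N, (a - b); split; first by rewrite subn_gt0.
    apply: leq_ltn_trans (leq_subr _ _) _.
    by rewrite ltnNge; move: ls; rewrite sP; apply: contra => /leq_sizeP ->.
  have Pk : P`_k != 0 by rewrite -sP.
  have Pl : P`_l != 0 by rewrite -sP.
  have -> : x ^+ (l - k) * q ^ (a - b) = T l / T k * (P`_l * q ^ b)^-1 * (P`_k * q ^ a).
    have xl : x ^+ l = x ^+ (l - k) * x ^+ k by rewrite -exprD subnK // ltnW.
    rewrite /T xl expfzDr // -invr_expz.
    have := expfz_neq0 b q0; have := expf_neq0 k x0.
    by move: (q ^ a) (q ^ b) (x ^+ k) (x ^+ (l - k)) => u v y z y0 v0; field; rewrite y0 v0 Pk Pl.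
  exact: R_unitM (R_unitM Ukl (R_unitV Ub)) Ua.
case: (ltngtP i j) => [ij|ij|ij]; last by rewrite ij eqxx in ji.
  by apply: (gap i j) => //; have := R_unitV U; rewrite invf_div.
exact: (gap j i).
Qed.

End Root_exponent.

(** A principal prime with finite residue field, in a form that covers both the
    integers and F[t]. *)
Record prime_residue (E : comNzRingType) := PrimeResidue {
  residue_field : finFieldType;
  residue : {rmorphism E -> residue_field};
  prime_gen : E;
  residue_onto : forall y, exists a, residue a = y;
  residue_ker : forall a, residue a = 0 -> exists b, a = prime_gen * b;
  prime_gen_neq0 : prime_gen != 0;
  residue_gen : residue prime_gen = 0;
  prime_gen_val : forall a, a != 0 ->
    exists n u, a = prime_gen ^+ n * u /\ residue u != 0 }.

Section Valuation_above.
Variables (K : fieldType) (E : comNzRingType) (iota : {rmorphism E -> K}).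
Variables (pi : prime_residue E) (B : nat).
Hypothesis iota_inj : injective iota.
Hypothesis iota_alg : forall x, exists P : {poly E},
  [/\ P != 0, (size P <= B.+1)%N & root (map_poly iota P) x].
Local Notation rho := (residue pi).
Local Notation p := (prime_gen pi).

(** A maximal subring R containing the image of E but not 1/p is a valuation
    ring.  Elements u of E outside the prime are units of R, as u u' = 1 - p b
    for suitable u' and b.  Hence every coefficient of an equation over E is a
    power of p up to a unit, and since the exponents d found by root_exponent
    are at most B, they all divide B!. *)
Lemma exists_finitePrime_above : exists v : finitePrime K,
  [/\ forall a, (0 <= v (iota a))%E, (0 < v (iota p))%E &
      forall u, rho u != 0 -> v (iota u) = 0%E].
Proof.
pose q := iota p; have q0 : q != 0 by rewrite /q -(rmorph0 iota) (inj_eq iota_inj) prime_gen_neq0.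
have [||||R [AR Rq' Rmax]] := @exists_maximal_subring K (range iota) q.
- by exists 1; rewrite ?rmorph1.
- by move=> _ _ [a _ <-] [b _ <-]; exists (a - b); rewrite ?rmorphB.
- by move=> _ _ [a _ <-] [b _ <-]; exists (a * b); rewrite ?rmorphM.
- move=> [a _ qa]; have /iota_inj pa1 : iota (p * a) = iota 1.
    by rewrite rmorphM rmorph1 qa divff.
  have := rmorph1 rho; rewrite -pa1 rmorphM residue_gen mul0r => /esym /eqP.
  by rewrite oner_eq0.
have Ra a : iota a \in R by apply: AR; exists a.
have Rtot := maximal_subring_total (Ra p) Rq' Rmax.
have Ru u : rho u != 0 -> R_unit R (iota u).
  move=> u0; have [u' u'E] := @residue_onto _ pi (rho u)^-1.
  have [|b bE] := @residue_ker _ pi (1 - u * u').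
    by rewrite rmorphB rmorph1 rmorphM u'E divff // subrr.
  have iu0 : iota u != 0.
    by apply: contraNneq u0; rewrite -(rmorph0 iota) => /iota_inj ->; rewrite rmorph0.
  rewrite /R_unit iu0 Ra; have -> : (iota u)^-1 = iota u' * (1 - q * iota b)^-1.
    rewrite -rmorphM -bE rmorphB rmorph1 opprB addrC subrK rmorphM invfM mulrCA.
    have [u'0|u'0] := eqVneq (iota u') 0; last by rewrite divff // mulr1.
    by move: u'E; move: u'0; rewrite -(rmorph0 iota) => /iota_inj ->;
      rewrite rmorph0 => /esym/eqP; rewrite invr_eq0 (negbTE u0).
  by rewrite rpredM // (inv_subMq (Ra p) Rq' Rmax).
have Re x : x != 0 -> exists n : int, R_unit R (x ^+ B`! * q ^ (- n)).
  move=> x0; have [P [P0 sP Px]] := iota_alg x.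
  have [||d [n [d0 dP U]]] := root_exponent Rtot q0 x0 _ Px.
  - by rewrite -size_poly_eq0 size_map_inj_poly ?rmorph0 // size_poly_eq0.
  - move=> i; have -> : (map_poly iota P)`_i = iota P`_i by rewrite coef_map.
    move=> Pi.
    have [|m [u [-> u0]]] := @prime_gen_val _ pi (P`_i).
      by apply: contraNneq Pi => ->; apply/eqP; exact: rmorph0.
    exists (- m%:Z); rewrite rmorphM rmorphXn -exprnN mulrAC divff ?expf_neq0 // mul1r.
    exact: Ru.
  move: dP; rewrite size_map_inj_poly ?rmorph0 // => dP.
  have dB : (d %| B`!)%N by rewrite dvdn_fact // d0 -ltnS (leq_trans dP).
  exists (- (n * (B`! %/ d)%N%:Z)); rewrite opprK -exprz_exp -exprnP.
  by rewrite -{1}(divnK dB) mulnC exprM -exprMn R_unitX.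
have [v [v_ge0 vq]] := valuation_ring_finitePrime (Ra p) Rq' Rtot (fact_gt0 B) Re.
exists v; split=> [a||u /Ru /and3P[u0 uR uR']] //; first exact: v_ge0.
apply/eqP; rewrite eq_le v_ge0 // andbT.
have := v_ge0 _ uR'.
have := ordPM v (iota u) (iota u)^-1; rewrite divff // ordP1.
have := ordP_fin v u0; case: (v (iota u)) => // n _.
have iu0 : (iota u)^-1 != 0 by rewrite invr_eq0.
have := ordP_fin v iu0; case: (v _) => // m _ [] /esym/eqP.
by rewrite addr_eq0 !lee_fin => /eqP ->; rewrite oppr_le0.
Qed.

End Valuation_above.

(** * Residue chains from valuations *)

(** This serves twice: the valuations above the n-th prime eventually leave S,
    and the prime ideals that they define are not contained in a finite set. *)
Lemma eventually_notin (T : Type) (F : nat -> T) (A : set T) : finite_set A ->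
  (forall n, exists N, forall j, (N <= j)%N -> F j <> F n) ->
  exists N, forall j, (N <= j)%N -> ~ A (F j).
Proof.
move=> Afin Fsep.
have /choice[g gP] x : exists N, forall j, (N <= j)%N -> F j <> x.
  have [[n <-]|nF] := pselect (exists n, F n = x); first exact: Fsep.
  by exists 0%N => j _ Fj; apply: nF; exists j.
have /finite_seqP[s sE] := finite_image g Afin.
exists (\max_(i <- s) i)%N => j sj AFj; apply: (gP (F j) j) => //.
apply: leq_trans sj; apply: leq_bigmax_seq => //.
by have : (g @` A) (g (F j)) by [exists (F j)]; rewrite sE.
Qed.

Lemma frequent_value (C : finType) (f : nat -> C) :
  exists y, forall N, exists2 j, (N <= j)%N & f j = y.
Proof.
apply: contrapT => nof.
have /choice[g gP] y : exists N, forall j, (N <= j)%N -> f j <> y.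
  apply: contrapT => noN; apply: nof; exists y => N.
  apply: contrapT => noj; apply: noN; exists N => j Nj fj; apply: noj.
  by exists j.
pose j := (\max_(y : C) g y)%N.
by apply: (gP (f j) j) => //; exact: leq_bigmax.
Qed.

Section SInteger_val.
Variables (R : realType) (K : fieldType) (S : set (primeOf R K)).
Implicit Types a b : SInteger S.

Lemma SInteger_val0 : SInteger_val (0 : SInteger S) = 0.
Proof. exact: (rmorph0 (val : {rmorphism SInteger S -> K})). Qed.

Lemma SInteger_val1 : SInteger_val (1 : SInteger S) = 1.
Proof. exact: (rmorph1 (val : {rmorphism SInteger S -> K})). Qed.

Lemma SInteger_valD a b : SInteger_val (a + b) = SInteger_val a + SInteger_val b.
Proof. exact: (rmorphD (val : {rmorphism SInteger S -> K})). Qed.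

Lemma SInteger_valB a b : SInteger_val (a - b) = SInteger_val a - SInteger_val b.
Proof. exact: (rmorphB (val : {rmorphism SInteger S -> K})). Qed.

Lemma SInteger_valM a b : SInteger_val (a * b) = SInteger_val a * SInteger_val b.
Proof. exact: (rmorphM (val : {rmorphism SInteger S -> K})). Qed.

Lemma SInteger_valX a n : SInteger_val (a ^+ n) = SInteger_val a ^+ n.
Proof. exact: (rmorphXn (val : {rmorphism SInteger S -> K})). Qed.

Lemma SInteger_val_sum (I : Type) (s : seq I) (P : pred I) (F : I -> SInteger S) :
  SInteger_val (\sum_(i <- s | P i) F i) = \sum_(i <- s | P i) SInteger_val (F i).
Proof. exact: (rmorph_sum (val : {rmorphism SInteger S -> K})). Qed.

Lemma prime_ideal_of_finitePrime (v : finitePrime K) (x : SInteger S) :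
  ~ S (Defs.Finite R v) -> x != 0 -> (0 < v (SInteger_val x))%E ->
  nonzero_prime_ideal (fun a : SInteger S => (0 < v (SInteger_val a))%E).
Proof.
move=> Sv x0 vx.
have v_ge0 a : (0 <= v (SInteger_val a))%E by have /asboolP/(_ v Sv) := valP a.
have memE a : (a \in (fun a : SInteger S => (0 < v (SInteger_val a))%E)) =
  (0 < v (SInteger_val a))%E by [].
split; last by exists x.
  split.
  - by rewrite memE SInteger_val0 ordP0.
  - by rewrite memE SInteger_val1 ordP1 ltxx.
  - move=> a u w; rewrite !memE => vu vw.
    rewrite SInteger_valD SInteger_valM; apply: lt_le_trans (ordPD _ _ _).
    by rewrite lt_min vw andbT ordPM (lt_le_trans vu) // leeDr // v_ge0.
move=> a b; rewrite !memE SInteger_valM ordPM.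
rewrite !lt_neqAle !v_ge0 !andbT; move: (v_ge0 a) (v_ge0 b) => va vb.
apply: contraTT; rewrite negb_or !negbK => /andP[/eqP <- /eqP <-].
by rewrite adde0 eqxx.
Qed.

End SInteger_val.

Section Permutation_chains.
Variables (R : realType) (K : fieldType) (S : set (primeOf R K)).
Hypothesis Sfin : finite_set S.
Variables (E : idomainType) (iota : {rmorphism E -> K}) (B : nat).
Hypothesis iota_inj : injective iota.
Hypothesis iota_alg : forall x, exists P : {poly E},
  [/\ P != 0, (size P <= B.+1)%N & root (map_poly iota P) x].
Hypothesis iotaS : forall a, iota a \in Sint S.
Variable pi : nat -> prime_residue E.
Hypothesis pi_sep : forall a, a != 0 ->
  exists N, forall j, (N <= j)%N -> residue (pi j) a != 0.
Variable t : E.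
Hypothesis t_inj : forall n, injective (fun D : {set 'I_n} => \sum_(i in D) t ^+ i).

Definition power_sum (T : finType) (D : {set T}) := \sum_(x in D) t ^+ enum_rank x.

Lemma power_sum_inj T : injective (@power_sum T).
Proof.
have W D : power_sum D = \sum_(i in (enum_rank @: D)%SET) t ^+ i :> E.
  by rewrite big_imset //= => x y _ _ /enum_rank_inj.
by move=> D D'; rewrite !W => /t_inj /(imset_inj (@enum_rank_inj _)).
Qed.

Lemma power_sum_blow_up (T : finType) m (f : T -> option 'I_m.+1) (J : {set 'I_m.+1}) :
  \sum_(j in J) power_sum (blow_up f [set j]%SET) = power_sum (blow_up f J).
Proof.
rewrite [RHS](partition_big (fun x => odflt ord0 (f x)) (mem J)) /=; last first.
  by move=> x; rewrite inE; case: (f x).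
apply: eq_bigr => j jJ; apply: eq_bigl => x; rewrite !inE.
case: (f x) => [i|] //=; rewrite inE; case: eqP => [->|]; first by rewrite jJ.
by rewrite andbF.
Qed.

Lemma blow_up_inj (T D : finType) (f : T -> option D) : onto f -> injective (blow_up f).
Proof.
move=> ft I J /setP IJ; apply/setP => j; have [x fx] := ft j.
by have := IJ x; rewrite !inE fx.
Qed.

Lemma interval_inj m (i j i' j' : 'I_m) : (i <= j)%N -> (i' <= j')%N ->
  [set l : 'I_m | (i <= l <= j)%N]%SET = [set l : 'I_m | (i' <= l <= j')%N]%SET ->
  i = i' /\ j = j'.
Proof.
move=> ij ij' /setP e.
have := e i; have := e j; have := e i'; have := e j'; rewrite !inE !leqnn ij ij' /=.
move=> /andP[_ h1] /andP[h2 _] /esym/andP[_ h3] /esym/andP[h4 _].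
by split; apply/val_inj/eqP; rewrite eqn_leq ?h1 ?h2 ?h3 ?h4.
Qed.

(** The colouring c n is attached to the n-th prime.  The colouring c0 occurs
    for infinitely many n, and the finite unions theorem is applied to it once,
    so that the sequence r does not depend on n.  The discriminant disc is the
    product of all differences of subset sums; only finitely many primes divide
    it. *)
Theorem exists_permutation_chain k m : exists r : 'I_m.+1 -> SInteger S,
  infinite_set [set P : SInteger S -> bool |
    nonzero_prime_ideal P /\ permutation_residue_chain k.+1 P r].
Proof.
have vex n := exists_finitePrime_above (pi n) iota_inj iota_alg.
have [v vP] := choice vex.
have v_gt0 n e : (0 < v n (iota e))%E = (residue (pi n) e == 0).
  have [v0 vp vu] := vP n; have [e0|/vu ->] := eqVneq (residue (pi n) e) 0; last exact: ltxx.
  have [b ->] := residue_ker e0.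
  by rewrite rmorphM ordPM (lt_le_trans vp) // leeDl.
have gen_sep n : exists N, forall j, (N <= j)%N -> ~~ (0 < v j (iota (prime_gen (pi n))))%E.
  have [N NP] := pi_sep (prime_gen_neq0 (pi n)).
  by exists N => j /NP; rewrite v_gt0.
have gen_in n : (0 < v n (iota (prime_gen (pi n))))%E by case: (vP n).
have [N1 N1P] : exists N, forall j, (N <= j)%N -> ~ S (Defs.Finite R (v j)).
  apply: eventually_notin Sfin _ => n; have [N NP] := gen_sep n.
  by exists N => j /NP /negP vj [] vjn; apply: vj; rewrite vjn.
have [T HT] := finite_unions 'I_k.+1 m.+1.
have chiex n : exists chi : E -> 'I_k.+1, forall a b, chi a = chi b ->
    exists e, residue (pi n) (a ^+ k * b - e ^+ k.+1) = 0.
  have [chi chiP] := power_class (residue_field (pi n)) k.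
  exists (fun a => chi (residue (pi n) a)) => a b /chiP[y yE].
  have [e eE] := residue_onto y; exists e.
  by rewrite rmorphB rmorphM !rmorphXn yE eE subrr.
have [chi chiP] := choice chiex.
pose c n := [ffun D : {set T} => chi n (power_sum D)].
have [c0 c0P] := frequent_value c.
have [f ft [k0 fc]] := HT c0.
pose W (J : {set 'I_m.+1}) := power_sum (blow_up f J).
pose x1 := W [set ord0]%SET.
pose disc := \prod_(J : {set 'I_m.+1}) \prod_(J' : {set 'I_m.+1} | J' != J) (W J - W J').
have disc0 : disc != 0.
  apply/prodf_neq0 => J _; apply/prodf_neq0 => J' J'J; rewrite subr_eq0.
  by apply: contraNneq J'J => /power_sum_inj /(blow_up_inj ft) ->.
have [N2 N2P] := pi_sep disc0.
have W_sep n J J' : (N2 <= n)%N -> residue (pi n) (W J - W J') = 0 -> J = J'.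
  move=> /N2P; rewrite rmorph_prod => /prodf_neq0 /(_ J isT).
  rewrite rmorph_prod => /prodf_neq0 h WJ; apply/eqP; rewrite eq_sym.
  by apply: contraT => /h; rewrite WJ eqxx.
pose r i := MkSInteger (iotaS (x1 ^+ k * W [set i]%SET)).
exists r => Gfin.
pose P n (a : SInteger S) : bool := (0 < v n (SInteger_val a))%E.
have [N3 N3P] : exists N, forall j, (N <= j)%N -> ~ [set P : SInteger S -> bool |
    nonzero_prime_ideal P /\ permutation_residue_chain k.+1 P r] (P j).
  apply: eventually_notin Gfin _ => n; have [N NP] := gen_sep n.
  exists N => j /NP vj E1.
  have := congr1 (fun Q => Q (MkSInteger (iotaS (prime_gen (pi n))))) E1.
  by rewrite /P /= gen_in (negbTE vj).
have [n nN cn] := c0P (maxn N1 (maxn N2 N3)).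
move: nN; rewrite !geq_max => /and3P[nN1 nN2 nN3].
apply: (N3P n nN3); split.
  apply: (@prime_ideal_of_finitePrime _ _ _ _ (MkSInteger (iotaS (prime_gen (pi n))))).
  - exact: N1P.
  - apply/eqP => /(congr1 (@SInteger_val R K S)).
    rewrite SInteger_val0 /= -(rmorph0 iota) => /iota_inj /eqP.
    by apply/negP; exact: prime_gen_neq0.
  - exact: gen_in.
move=> s; pose J (i j : 'I_m.+1) := (s @: [set l : 'I_m.+1 | (i <= l <= j)%N])%SET.
have sumE i j : SInteger_val (interval_sum (fun l => r (s l)) i j) =
    iota (x1 ^+ k * W (J i j)).
  rewrite /interval_sum SInteger_val_sum /= -rmorph_sum -mulr_sumr.
  congr (iota (_ * _)); rewrite /W -power_sum_blow_up big_imset /=; last first.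
    by move=> x y _ _ /perm_inj.
  by apply: eq_bigl => l; rewrite inE.
split=> [i j ij|i j i' j' ij ij'].
  have J0 : J i j != finset.set0.
    by apply/finset.set0Pn; exists (s i); rewrite imset_f // inE leqnn.
  have chi_eq : chi n x1 = chi n (W (J i j)).
    have cW I : I != finset.set0 -> chi n (W I) = k0.
      by move=> /fc; rewrite -cn ffunE.
    by rewrite !cW //; apply/finset.set0Pn; exists ord0; rewrite inE.
  have [e eE] := chiP n _ _ chi_eq.
  exists (MkSInteger (iotaS e)).
  suff : P n (interval_sum (fun l => r (s l)) i j - MkSInteger (iotaS e) ^+ k.+1) by [].
  by rewrite /P SInteger_valB SInteger_valX sumE /= -rmorphXn -rmorphB v_gt0 eE.
move=> IJ; have {IJ} : P n (interval_sum (fun l => r (s l)) i j -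
  interval_sum (fun l => r (s l)) i' j') by [].
rewrite /P SInteger_valB !sumE -rmorphB -mulrBr v_gt0 rmorphM mulf_eq0 rmorphXn.
have x1_neq0 : residue (pi n) x1 != 0.
  apply/eqP => x10; have W0 : W finset.set0 = 0.
    by rewrite /W /power_sum big1 // => x; rewrite inE; case: (f x) => // i0; rewrite inE.
  have /setP/(_ ord0) : [set ord0 : 'I_m.+1]%SET = finset.set0.
    by apply: (W_sep n) => //; rewrite W0 subr0.
  by rewrite !inE.
rewrite (negbTE (expf_neq0 _ x1_neq0)) /= => /eqP /(W_sep _ _ _ nN2).
by move=> /(imset_inj (@perm_inj _ s)); exact: interval_inj.
Qed.

End Permutation_chains.

(** * Primes of the two base rings *)

(** Division by p terminates since the size mu decreases. *)
Lemma prime_multiplicity (E : idomainType) (L : nzRingType) (rho : {rmorphism E -> L})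
    (p : E) (mu : E -> nat) :
  (forall a, rho a = 0 -> exists b, a = p * b) ->
  (forall b, b != 0 -> (mu b < mu (p * b)%R)%N) ->
  forall a, a != 0 -> exists n u, a = p ^+ n * u /\ rho u != 0.
Proof.
move=> ker mu_lt a; have [N] := ubnP (mu a); elim: N a => // N IH a aN a0.
have [/ker[b ab]|ra] := eqVneq (rho a) 0; last by exists 0%N, a; rewrite expr0 mul1r.
have b0 : b != 0 by apply: contraNneq a0 => b0; rewrite ab b0 mulr0.
have [|//|n [u [bE u0]]] := IH b.
  by rewrite -ltnS (leq_trans _ aN) // ltnS ab mu_lt.
by exists n.+1, u; rewrite ab bE exprS mulrA.
Qed.

Lemma intr_Fp_eq0 p (n : int) : prime p -> (n%:~R == 0 :> 'F_p) = (p %| `|n|)%N.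
Proof.
move=> pr; rewrite (dvdn_pcharf (pchar_Fp pr)).
case: n => n //=; by rewrite NegzE mulrNz oppr_eq0.
Qed.

Lemma int_prime_residue p : prime p ->
  exists2 P : prime_residue int, prime_gen P = p%:Z &
    forall a, residue P a != 0 = ~~ (p %| `|a|)%N.
Proof.
move=> pr; pose rho : {rmorphism int -> 'F_p} := intr.
have onto y : exists a, rho a = y.
  by exists (val y)%:Z; rewrite /= -pmulrn natr_Zp.
have ker a : rho a = 0 -> exists b, a = p%:Z * b.
  move=> /eqP; rewrite intr_Fp_eq0 // => pa.
  have /dvdzP[b ->] : (p%:Z %| a)%Z by rewrite dvdzE.
  by exists b; rewrite mulrC.
have p0 : p%:Z != 0 by rewrite -lt0n prime_gt0.
have rp : rho p%:Z = 0 by apply/eqP; rewrite intr_Fp_eq0 // dvdnn.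
have pval : forall a, a != 0 -> exists n u, a = p%:Z ^+ n * u /\ rho u != 0.
  apply: (prime_multiplicity (mu := absz)) => // b b0.
  by rewrite abszM ltn_Pmull ?absz_gt0 // prime_gt1.
exists (PrimeResidue onto ker p0 rp pval) => // a.
by rewrite /= intr_Fp_eq0.
Qed.

Lemma poly_prime_residue (F : finFieldType) (h : {poly F}) :
  irreducible_poly h -> h \is monic ->
  exists2 P : prime_residue {poly F}, prime_gen P = h &
    forall a, (residue P a == 0) = (h %| a).
Proof.
move=> hirr hmon; pose hI : monic_irreducible_poly h := (hirr, hmon).
pose rho : {rmorphism {poly F} -> {poly %/ h with hI}} := in_qpoly h.
have h1 : (1 < size h)%N := hirr.1.
have rhoE a : (rho a == 0) = (h %| a).
  by rewrite -(inj_eq val_inj) /= /mk_monic h1 hmon /= -Pdiv.IdomainMonic.modpE ?hmon.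
have onto y : exists a, rho a = y.
  by exists (val y); apply: val_inj; exact: (in_qpoly_small (size_mk_monic _)).
have ker a : rho a = 0 -> exists b, a = h * b.
  by move=> /eqP; rewrite rhoE => /dvdpP[b ->]; exists b; rewrite mulrC.
have h0 : h != 0 by rewrite monic_neq0.
have rh : rho h = 0 by apply/eqP; rewrite rhoE dvdpp.
have hval : forall a, a != 0 -> exists n u, a = h ^+ n * u /\ rho u != 0.
  apply: (prime_multiplicity (mu := fun a : {poly F} => size a)) => // b b0.
  rewrite size_mul // -subn1 addnC -addnBA ?(ltnW h1) //.
  by rewrite -[X in (X < _)%N]addn0 ltn_add2l subn_gt0.
by exists (PrimeResidue onto ker h0 rh hval).
Qed.

Lemma exists_irreducible_divisor (F : fieldType) (p : {poly F}) : (1 < size p)%N ->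
  exists h : {poly F}, [/\ irreducible_poly h, h \is monic & h %| p].
Proof.
have [n] := ubnP (size p); elim: n p => // n IH p sn sp.
have p0 : p != 0 by rewrite -size_poly_gt0 (ltn_trans _ sp).
have [irr|] := pselect (irreducible_poly p).
  exists ((lead_coef p)^-1 *: p); have l0 : (lead_coef p)^-1 != 0.
    by rewrite invr_eq0 lead_coef_eq0.
  split; last by rewrite dvdpZl.
    split; first by rewrite size_scale.
    move=> q q1; rewrite dvdpZr // => qp; apply: eqp_trans (irr.2 q q1 qp) _.
    by rewrite eqp_sym eqp_scale.
  by rewrite monicE lead_coefZ mulVf // lead_coef_eq0.
move=> /not_andP[//|/existsNP[q /not_implyP[q1 /not_implyP[qp /negP nqp]]]].
have q0 : q != 0 by apply: contraNneq p0 => q0; move: qp; rewrite q0 dvd0p.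
have [||h [hirr hm hq]] := IH q.
- rewrite -ltnS (leq_trans _ sn) // ltnS ltn_neqAle dvdp_leq // andbT.
  by apply: contra nqp; rewrite dvdp_size_eqp.
- by rewrite ltn_neqAle eq_sym q1 size_poly_gt0.
- by exists h; split=> //; exact: dvdp_trans hq qp.
Qed.

(** Euclid's argument, applied to the product of all nonzero polynomials of
    size at most n; the factor X keeps the result from being constant. *)
Lemma exists_large_irreducible (F : finFieldType) n :
  exists h : {poly F}, [/\ irreducible_poly h, h \is monic & (n < size h)%N].
Proof.
pose G : {poly F} := 'X * \prod_(q : {poly_n F} | val q != 0) val q.
have P0 : \prod_(q : {poly_n F} | val q != 0) val q != 0 by apply/prodf_neq0.
have sG : (1 < size G)%N.
  by rewrite size_mul ?polyX_eq0 // size_polyX !addSn add0n ltnS size_poly_gt0.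
have [|h [hirr hm hG]] := @exists_irreducible_divisor F (G + 1).
  by rewrite size_polyDl // size_poly1.
exists h; split=> //; rewrite ltnNge; apply/negP => hn.
have : h %| 1.
  rewrite -(dvdp_addr 1 (m := G)) //.
  have vh : val (npolyp n h) = h by exact: npolypK.
  by rewrite dvdp_mull // (bigD1 (npolyp n h)) /= vh ?monic_neq0 // dvdp_mulr.
move=> /(dvdp_leq (oner_neq0 _)); rewrite size_poly1 leqNgt.
by case: hirr => ->.
Qed.

(** * Number fields *)

Lemma binary_digits_inj n : forall b c : nat -> bool,
  (\sum_(i < n) b i * 2 ^ i = \sum_(i < n) c i * 2 ^ i)%N ->
  forall i, (i < n)%N -> b i = c i.
Proof.
elim: n => // n IH b c; rewrite !big_ord_recl /= !muln1 => E.
have tail (d : nat -> bool) :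
    (\sum_(i < n) d (bump 0 i) * 2 ^ bump 0 i = (\sum_(i < n) d i.+1 * 2 ^ i).*2)%N.
  by rewrite -muln2 big_distrl; apply: eq_bigr => i _; rewrite expnSr mulnA.
rewrite !tail in E.
have bc : b 0%N = c 0%N.
  by have := congr1 odd E; rewrite !oddD !odd_double !addbF !oddb.
move: E; rewrite bc => /addnI /double_inj E [|i] // ilt.
exact: (IH (fun i => b i.+1) (fun i => c i.+1) E i).
Qed.

Lemma power_sum2_inj n : injective (fun D : {set 'I_n} => \sum_(i in D) (2 : int) ^+ i).
Proof.
pose digit (D : {set 'I_n}) (i : nat) := [exists j in D, val j == i].
have digitE D (i : 'I_n) : digit D i = (i \in D).
  by apply/exists_inP/idP => [[j jD /eqP/val_inj <-] //|iD]; exists i.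
have E (D : {set 'I_n}) : \sum_(i in D) (2 : int) ^+ i =
    (\sum_(i < n) digit D i * 2 ^ i)%N%:Z.
  rewrite big_mkcond (big_morph Posz PoszD (erefl _)); apply: eq_bigr => i _.
  by rewrite digitE; case: ifP; rewrite ?mul0n // mul1n -natrX natz.
move=> D D'; rewrite !E => -[h]; apply/setP => i; rewrite -!digitE.
exact: (@binary_digits_inj n (digit D) (digit D') h i (ltn_ord i)).
Qed.

Lemma number_field_algebraic (K : fieldExtType rat) (x : K) :
  exists P : {poly int}, [/\ P != 0, (size P <= (\dim {:K}).+1)%N &
    root (map_poly (intr : int -> K) P) x].
Proof.
have /polyOver1P[q qE] := minPolyOver 1%AS x.
have [P [a a0 PE]] := rat_poly_scale q.
have PK : map_poly (intr : int -> K) P = map_poly (in_alg K) (map_poly (intr : int -> rat) P).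
  rewrite -map_poly_comp; apply: eq_map_poly => n.
  by rewrite /= -[LHS](rmorph_int (in_alg K)).

have pq : map_poly (intr : int -> rat) P = a%:~R *: q.
  by rewrite PE scalerA mulfV ?intr_eq0 // scale1r.
have a0' : a%:~R != 0 :> rat by rewrite intr_eq0.
have sP : size P = (adjoin_degree 1%AS x).+1.
  rewrite -size_minPoly qE size_map_poly -(size_scale q a0') -pq.
  by rewrite size_map_inj_poly //; exact: intr_inj.
exists P; split.
- by rewrite -size_poly_gt0 sP.
- rewrite sP ltnS adjoin_degreeE dimv1 divn1; exact: dimvS (subvf _).
apply/rootP; rewrite PK pq map_polyZ -qE hornerZ.
by rewrite minPolyxx mulr0.
Qed.

(** The n-th prime is any prime number larger than n, so that it does not divide
    a nonzero integer a once n >= |a|. *)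
Lemma number_field_permutation_chain (R : realType) (K : fieldExtType rat)
    (S : set (primeOf R K)) k m : finite_set S ->
  exists r : 'I_m.+1 -> SInteger S, infinite_set [set P : SInteger S -> bool |
    nonzero_prime_ideal P /\ permutation_residue_chain k.+1 P r].
Proof.
move=> Sfin; pose iota : {rmorphism int -> K} := intr.
have iota_inj : injective iota.
  apply: raddf_inj => n /eqP; rewrite /= -[_%:~R](rmorph_int (in_alg K)) /= scaler_eq0.
  by rewrite oner_eq0 orbF intr_eq0 => /eqP.
have iotaS a : iota a \in Sint S by rewrite rpred_int.
have piex n : exists P : prime_residue int, forall a, a != 0 -> (`|a| <= n)%N -> residue P a != 0.
  have [p np pr] := prime_above n; have [P _ resP] := int_prime_residue pr.
  exists P => a a0 an; rewrite resP; apply/negP => /dvdn_leq.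
  by rewrite absz_gt0 a0 leqNgt (leq_ltn_trans an) // => /(_ isT).
have [pi piP] := choice piex.
apply: (@exists_permutation_chain R K S Sfin int iota _ iota_inj
  (@number_field_algebraic K) iotaS pi _ 2 power_sum2_inj).
by move=> a a0; exists `|a|%N => j aj; exact: piP.
Qed.

(** * Dependence over a polynomial subring of a function field *)

Lemma fraction_denominator (D : idomainType) (x : {fraction D}) :
  exists d n, d != 0 /\ FracField.tofrac d * x = FracField.tofrac n.
Proof.
elim/quotW: x => y; exists (frac y).2, (frac y).1; split; first exact: denom_ratioP.
unlock FracField.tofrac; rewrite -[LHS]FracField.pi_mul; apply/eqmodP => /=.
by rewrite FracField.equivfE /FracField.mulf /= !numden_Ratio
  ?mul1r ?oner_neq0 ?mulf_neq0 ?denom_ratioP //= mulr1 mulrC.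
Qed.

Definition poly_eval (F : comNzRingType) (K : comNzRingType) (c : {rmorphism F -> K})
  (z : K) : {rmorphism {poly F} -> K} :=
  horner_eval z \o map_poly c.

Arguments poly_eval : simpl never.

Lemma poly_evalE (F K : comNzRingType) (c : {rmorphism F -> K}) z (p : {poly F}) :
  poly_eval c z p = (map_poly c p).[z].
Proof. by []. Qed.

Section Function_field_dependence.
Variables (F : finFieldType) (K : fieldExtType {fraction {poly F}}).

Definition poly_embedding : {rmorphism {poly F} -> K} :=
  in_alg K \o @FracField.tofrac {poly F}.

Definition const_embedding : {rmorphism F -> K} := poly_embedding \o polyC.

Local Notation psi := poly_embedding.
Local Notation phi := const_embedding.
Local Notation N := (\dim {:K}).
Local Notation b := (vbasis {:K}).

Lemma poly_embedding_eq0 (p : {poly F}) : (psi p == 0) = (p == 0).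
Proof. by rewrite fmorph_eq0 tofrac_eq0. Qed.

(** In coordinates over F(x), with respect to a fixed basis of K, these are the
    vectors of polynomials of size at most s. *)
Definition size_bounded s (a : K) := exists2 g : 'I_N -> {poly F},
  forall i, (size (g i) <= s)%N & a = \sum_i psi (g i) * b`_i.

Lemma size_bounded_mul s a (p : {poly F}) :
  size_bounded s a -> size_bounded (s + size p) (psi p * a).
Proof.
move=> [g gs ->]; exists (fun i => p * g i) => [i|].
  apply: leq_trans (size_polyMleq _ _) _; apply: leq_trans (leq_pred _) _.
  by rewrite addnC leq_add2r.
by rewrite mulr_sumr; apply: eq_bigr => i _; rewrite rmorphM mulrA.
Qed.

Lemma size_bounded_le s s' a : (s <= s')%N -> size_bounded s a -> size_bounded s' a.
Proof. by move=> ss' [g gs ->]; exists g => // i; exact: leq_trans (gs i) ss'. Qed.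

Lemma size_bounded_sum (I : finType) s (a : I -> K) :
  (forall i, size_bounded s (a i)) -> size_bounded s (\sum_i a i).
Proof.
move=> aG; apply: big_ind => [|_ _ [g gs ->] [h hs ->]|//].
  exists (fun=> 0) => [i|]; first by rewrite size_poly0.
  by rewrite big1 // => i _; rewrite rmorph0 mul0r.
exists (fun i => g i + h i) => [i|].
  by rewrite (leq_trans (size_polyD _ _)) // geq_max gs hs.
by rewrite -big_split; apply: eq_bigr => i _; rewrite rmorphD mulrDl.
Qed.

Lemma common_denominator (I : finType) (a : I -> K) :
  exists d s, d != 0 /\ forall i, size_bounded s (psi d * a i).
Proof.
have single (x : K) : exists d s, d != 0 /\ size_bounded s (psi d * x).
  have fex i := fraction_denominator (coord b i x).
  have [d dP] := choice fex; have [n nP] := choice dP.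
  pose g i := \prod_(j | j != i) d j * n i.
  exists (\prod_i d i), (\max_i size (g i)); split.
    by apply/prodf_neq0 => i _; case: (nP i).
  exists g => [i|]; first exact: leq_bigmax.
  rewrite {1}(coord_vbasis (memvf x)) mulr_sumr; apply: eq_bigr => i _.
  have psiE p (y : K) : psi p * y = FracField.tofrac p *: y by rewrite /= mulr_algl.
  rewrite !psiE scalerA; congr (_ *: _).
  by rewrite (bigD1 i) //= !rmorphM mulrAC (nP i).2 mulrC.
have [d dP] := choice (fun i => single (a i)); have [s sP] := choice dP.
pose e i := \prod_(j | j != i) d j.
exists (\prod_i d i), (\max_i (s i + size (e i))); split.
  by apply/prodf_neq0 => i _; case: (sP i).
move=> i; apply: (@size_bounded_le (s i + size (e i))); first exact: leq_bigmax.
have -> : \prod_i d i = e i * d i by rewrite (bigD1 i) //= mulrC.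
rewrite rmorphM -mulrA.
by apply: size_bounded_mul; case: (sP i).
Qed.

Lemma size_bounded_mulz (z : K) : exists d C, d != 0 /\
  forall s a, size_bounded s a -> size_bounded (s + C) (psi d * z * a).
Proof.
have [d [C [d0 dC]]] := common_denominator (fun i : 'I_N => z * b`_i).
exists d, C; split=> // s _ [g gs ->].
rewrite mulr_sumr; apply: size_bounded_sum => i.
rewrite mulrCA -mulrA.
apply: (@size_bounded_le (C + size (g i))); first by rewrite addnC leq_add2r.
exact: size_bounded_mul (dC i).
Qed.

(** The linear combinations, multiplied by d, have coordinates in a space of
    dimension N * s over F, so two of the combinations coincide. *)
Lemma size_bounded_dependent (I : finType) s (a : I -> K) (d : {poly F}) :
  d != 0 -> (forall i, size_bounded s (psi d * a i)) -> (N * s < #|I|)%N ->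
  exists2 c : I -> F, exists i, c i != 0 & \sum_i phi (c i) * a i = 0.
Proof.
move=> d0 aG sI.
have gex i : exists g : 'I_N -> {poly F}, (forall j, (size (g j) <= s)%N) /\
    psi d * a i = \sum_j psi (g j) * b`_j.
  by have [g gs gE] := aG i; exists g.
have [g gP] := choice gex.
pose coefs (c : {ffun I -> F}) : 'M[F]_(N, s) :=
  \matrix_(j, l) \sum_i c i * (g i j)`_l.
have /injectivePn[c [c' cc' coefs_cc']] : ~~ injectiveb coefs.
  apply/negP => /injectiveP/leq_card; apply/negP; rewrite -ltnNge card_mx card_ffun.
  by rewrite ltn_exp2l // card_finNzRing_gt1.
exists (fun i => c i - c' i).
  apply: contrapT => all0; case/eqP: cc'; apply/ffunP => i; apply/eqP.
  by rewrite -subr_eq0; apply: contraT => ci; case: all0; exists i.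
have psi_d : psi d != 0 by rewrite poly_embedding_eq0.
apply: (mulfI psi_d); rewrite mulr0 mulr_sumr.
transitivity (\sum_j psi (\sum_i (c i - c' i) *: g i j) * b`_j).
  under [RHS]eq_bigr => j _ do rewrite rmorph_sum mulr_suml.
  rewrite exchange_big /=; apply: eq_bigr => i _.
  rewrite mulrCA (gP i).2 mulr_sumr; apply: eq_bigr => j _.
  rewrite mulrA; congr (_ * _).
  by rewrite -mul_polyC; exact: esym (rmorphM psi _ _).
apply: big1 => j _; suff -> : \sum_i (c i - c' i) *: g i j = 0 by rewrite rmorph0 mul0r.
apply/polyP => l; rewrite coef0 coef_sum; under eq_bigr => i _ do rewrite coefZ.
have [ls|sl] := ltnP l s; last first.
  by rewrite big1 // => i _; rewrite nth_default ?mulr0 // (leq_trans ((gP i).1 j)).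
move/matrixP: coefs_cc' => /(_ j (Ordinal ls)); rewrite !mxE /= => /eqP.
rewrite -subr_eq0 -sumrB => /eqP coefs0; rewrite -[RHS]coefs0.
by apply: eq_bigr => i _; rewrite mulrBl.
Qed.

(** K has finite dimension over F(z).  Multiplication by z, after clearing
    denominators, raises sizes by a constant, so the products z^l a_i with
    l <= n have sizes growing linearly in n with a slope C1 that does not depend
    on the a_i.  Their number, M (n+1), outgrows the dimension N (s0 + n C1 + 1)
    of the space in which they lie as soon as M > N C1. *)
Lemma function_field_dependence (z : K) : exists B, forall a : 'I_B -> K,
  exists2 c : 'I_B -> {poly F}, exists i, c i != 0 &
    \sum_i poly_eval phi z (c i) * a i = 0.
Proof.
have [d [C [d0 dC]]] := size_bounded_mulz z.
(* C1 is the growth of sizes per power of z: multiplication by d z costs C, and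
   the powers of d that are missing cost at most size d each. *)
pose C1 := (C + size d)%N; pose M := (N * C1).+1; exists M => a.
have [d' [s0 [d'0 aG]]] := common_denominator a.
pose n := (N * s0.+1)%N.
have zG (i : 'I_M) l : size_bounded (s0 + l * C) (psi (d ^+ l * d') * (z ^+ l * a i)).
  elim: l => [|l IH]; first by rewrite !expr0 !mul1r mul0n addn0.
  have -> : psi (d ^+ l.+1 * d') * (z ^+ l.+1 * a i) =
      psi d * z * (psi (d ^+ l * d') * (z ^+ l * a i)).
    rewrite !exprS -[d * _ * d']mulrA (rmorphM psi d) -[z * _ * _]mulrA.
    exact: mulrACA.
  by rewrite mulSnr addnA; exact: dC.
have zG' (i : 'I_M) l : (l <= n)%N ->
    size_bounded (s0 + n * C1).+1 (psi (d ^+ n * d') * (z ^+ l * a i)).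
  move=> ln; have -> : d ^+ n * d' = d ^+ (n - l) * (d ^+ l * d').
    by rewrite mulrA -exprD subnK.
  rewrite rmorphM -mulrA; apply: (size_bounded_le _ (size_bounded_mul _ (zG i l))).
  apply: leq_trans (leq_add (leqnn _) (size_poly_exp_leq _ _)) _.
  rewrite addnS ltnS -addnA leq_add2l mulnDr; apply: leq_add.
    by rewrite leq_mul2r ln orbT.
  by rewrite mulnC leq_mul ?leq_subr ?leq_pred.
have [|||c [[i l] cil] cE] := @size_bounded_dependent ('I_M * 'I_n.+1)%type
    (s0 + n * C1).+1 (fun il => z ^+ il.2 * a il.1) (d ^+ n * d').
- by rewrite mulf_neq0 ?expf_neq0.
- by move=> [i l]; apply: zG'; rewrite -ltnS.
- rewrite card_prod !card_ord /M /n; nia.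
exists (fun i => \poly_(l < n.+1) c (i, inord l)).
  exists i; apply/eqP => /polyP/(_ l); rewrite coef_poly ltn_ord inord_val coef0.
  exact/eqP.
rewrite -[RHS]cE [RHS](eq_bigr (fun il => phi (c (il.1, il.2)) * (z ^+ il.2 * a il.1)));
  last by case.
rewrite -(pair_big xpredT xpredT (fun i l => phi (c (i, l)) * (z ^+ l * a i))) /=.
apply: eq_bigr => j _; pose p := \poly_(l < n.+1) c (j, inord l).
rewrite -[X in X * _]/((map_poly phi p).[z]).
have sp : (size (map_poly phi p) <= n.+1)%N.
  by rewrite size_map_poly size_poly.
rewrite (horner_coef_wide _ sp) mulr_suml; apply: eq_bigr => l' _.
by rewrite coef_map coef_poly ltn_ord inord_val mulrA.
Qed.

End Function_field_dependence.

(** * Weak approximation *)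

Section Valuation_calculus.
Variables (K : fieldType) (v : finitePrime K).
Implicit Types (a b x : K) (n m : int).

Lemma ord_eq_int a : a != 0 -> exists n, v a = n%:E.
Proof. by move=> /(ordP_fin v); case: (v a) => // n _; exists n. Qed.

Lemma ord_int_neq0 a n : v a = n%:E -> a != 0.
Proof. by apply: contra_eq_neq => ->; rewrite ordP0. Qed.

Lemma ord_lt0_int a : (v a < 0)%E -> exists2 n, v a = n%:E & n < 0.
Proof.
move=> va; have [|n vn] := @ord_eq_int a.
  by apply: contraTneq va => ->; rewrite ordP0 ltNge leey.
by exists n; rewrite // -lte_fin -vn.
Qed.

Lemma ord_intM a b n m : v a = n%:E -> v b = m%:E -> v (a * b) = (n + m)%:E.
Proof. by move=> va vb; rewrite ordPM va vb. Qed.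

Lemma ord_intX a n k : v a = n%:E -> v (a ^+ k) = (n *+ k)%:E.
Proof.
move=> va; elim: k => [|k IH]; first by rewrite expr0 ordP1.
by rewrite exprS (ord_intM va IH) mulrS.
Qed.

Lemma ord_intV a n : v a = n%:E -> v a^-1 = (- n)%:E.
Proof.
move=> va; have a0 := ord_int_neq0 va.
have [|m vm] := @ord_eq_int a^-1; first by rewrite invr_eq0.
have := ord_intM va vm; rewrite divff // ordP1 vm => -[] /eqP.
by rewrite eq_sym addrC addr_eq0 => /eqP ->.
Qed.

Lemma ordPN a : v (- a) = v a.
Proof. by rewrite -mulN1r ordPM ordPN1 add0e. Qed.

Lemma ord_geD n a b : (n%:E <= v a)%E -> (n%:E <= v b)%E -> (n%:E <= v (a + b)%R)%E.
Proof. by move=> va vb; apply: le_trans (ordPD _ _ _); rewrite le_min va vb. Qed.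

Lemma ord_ge_sum n (I : Type) (s : seq I) (P : pred I) (f : I -> K) :
  (forall i, P i -> (n%:E <= v (f i))%E) -> (n%:E <= v (\sum_(i <- s | P i) f i)%R)%E.
Proof.
move=> fn; apply: (big_ind (fun x => (n%:E <= v x)%E)) => //.
  by rewrite ordP0 leey.
by move=> *; exact: ord_geD.
Qed.

Lemma ord_geM n m a b : (n%:E <= v a)%E -> (m%:E <= v b)%E ->
  ((n + m)%:E <= v (a * b)%R)%E.
Proof. by move=> va vb; rewrite ordPM EFinD leeD. Qed.

Lemma ord_ge0X a k : (0 <= v a)%E -> (0 <= v (a ^+ k)%R)%E.
Proof.
move=> va; elim: k => [|k IH]; first by rewrite expr0 ordP1.
by rewrite exprS ordPM adde_ge0.
Qed.

Lemma ord_dominant n a b : v a = n%:E -> ((n + 1)%:E <= v b)%E -> v (a + b) = n%:E.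
Proof.
move=> va vb; have vab : (n%:E <= v (a + b)%R)%E.
  by rewrite ord_geD // ?va // (le_trans _ vb) // lee_fin lerDl.
apply/eqP; rewrite eq_le vab andbT leNgt; apply/negP => vab'.
have : ((n + 1)%:E <= v (a + b - b)%R)%E.
  apply: ord_geD; rewrite ?ordPN //.
  move: vab'; case: (v (a + b)) => [m||] //=; last by rewrite leey.
  by rewrite lte_fin lee_fin lezD1.
by rewrite addrK va lee_fin gerDl.
Qed.

(** At a pole of x the leading term of the equation would dominate. *)
Lemma ord_ge0_monic_root D x (e : 'I_D -> K) : (forall i, (0 <= v (e i))%E) ->
  x ^+ D = \sum_(i < D) e i * x ^+ i -> (0 <= v x)%E.
Proof.
move=> e0 xD; rewrite leNgt; apply/negP => /ord_lt0_int[n vx n0].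
have : ((n *+ D + 1)%:E <= v (x ^+ D)%R)%E.
  rewrite xD; apply: ord_ge_sum => i _; rewrite -[_ + 1]add0r.
  apply: ord_geM => //; rewrite (ord_intX _ vx) lee_fin.
  have -> : n *+ D = n *+ i + n *+ (D - i) by rewrite -mulrnDr subnKC // ltnW.
  have : n *+ (D - i) <= n.
    rewrite -[(D - i)%N]prednK ?subn_gt0 // mulrS gerDl.
    by rewrite mulrn_wle0 // ltW.
  by rewrite -addrA gerDl => le; move: n0; rewrite -lezD1; apply: le_trans; rewrite lerD2r.
by rewrite (ord_intX _ vx) lee_fin gerDl.
Qed.

(** Nonzero constants are roots of unity. *)
Lemma ord_const (F : finFieldType) (phi : {rmorphism F -> K}) (c : F) :
  c != 0 -> v (phi c) = 0%E.
Proof.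
move=> c0; have [|n vn] := @ord_eq_int (phi c); first by rewrite fmorph_eq0.
have := ord_intX #|F| vn; rewrite -rmorphXn expf_card vn => -[] /esym/eqP.
rewrite -subr_eq0 -[X in _ - X]mulr1n -mulrnBr ?(ltnW (card_finNzRing_gt1 F)) //.
by rewrite mulrn_eq0 subn_eq0 leqNgt card_finNzRing_gt1 /= => /eqP ->.
Qed.

Lemma ord_const_ge0 (F : finFieldType) (phi : {rmorphism F -> K}) (c : F) :
  (0 <= v (phi c))%E.
Proof.
by have [->|/(ord_const phi) ->] := eqVneq c 0; rewrite ?rmorph0 ?ordP0 ?leey.
Qed.

End Valuation_calculus.

Lemma finitePrime_eq (K : fieldType) (v w : finitePrime K) :
  (forall x, v x = w x) -> v = w.
Proof.
case: v => v v0 vf vM vD vn; case: w => w w0 wf wM wD wn /= vw.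
have {}vw : v = w by apply/funext.
case: w / vw in w0 wf wM wD wn *.
by congr FinitePrime; exact: Prop_irrelevance.
Qed.

(** Otherwise the ring of w lies in that of v, units of w are units of v, and
    writing an element as a power of a uniformizer u of w times a unit shows
    that v is a multiple of w; normalization makes them equal. *)
Lemma exists_pole_integral (K : fieldType) (v w : finitePrime K) : v <> w ->
  exists2 a, (v a < 0)%E & (0 <= w a)%E.
Proof.
move=> vw; apply: contrapT => none.
have sub a : (0 <= w a)%E -> (0 <= v a)%E.
  by move=> wa; rewrite leNgt; apply/negP => va; apply: none; exists a.
have unit a : w a = 0%E -> v a = 0%E.
  move=> wa; have va : (0 <= v a)%E by rewrite sub // wa.
  have va' : (0 <= v (a^-1)%R)%E by rewrite sub // (ord_intV wa) oppr0.
  have [|n vn] := @ord_eq_int _ v a; first exact: ord_int_neq0 wa.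
  move: va va'; rewrite (ord_intV vn) vn !lee_fin oppr_ge0 => n0 n0'.
  by congr (_%:E); apply/eqP; rewrite eq_le n0 n0'.
have [u wu] := ordP_normalized w.
have [|m vu] := @ord_eq_int _ v u; first exact: ord_int_neq0 wu.
have m0 : 0 <= m by rewrite -lee_fin -vu sub // wu.
have vE a n : w a = n%:E -> v a = (m * n)%:E.
  case: n => n wa; last first.
    have w1 : w (a * u ^+ n.+1) = 0%E by rewrite (ord_intM wa (ord_intX _ wu)) NegzE natz addNr.
    have [|l va] := @ord_eq_int _ v a; first exact: ord_int_neq0 wa.
    have := unit _ w1; rewrite (ord_intM va (ord_intX _ vu)) => -[] /eqP.
    by rewrite addr_eq0 va => /eqP ->; rewrite NegzE mulrN -mulr_natr natz.
  have w1 : w (a * (u ^+ n)^-1) = 0%E.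
    by rewrite (ord_intM wa (ord_intV (ord_intX _ wu))) natz subrr.
  have [|l va] := @ord_eq_int _ v a; first exact: ord_int_neq0 wa.
  have := unit _ w1; rewrite (ord_intM va (ord_intV (ord_intX _ vu))) => -[] /eqP.
  by rewrite subr_eq0 va => /eqP ->; rewrite -mulr_natr natz.
have m1 : m = 1.
  have [a va] := ordP_normalized v.
  have [|n wn] := @ord_eq_int _ w a; first exact: ord_int_neq0 va.
  have := vE _ _ wn; rewrite va => -[].
  case: m m0 {vE vu} => // m _ /(congr1 absz); rewrite abszM /= => /esym/eqP.
  by rewrite muln_eq1 => /andP[/eqP -> _].
apply: vw; apply: finitePrime_eq => a.
have [->|a0] := eqVneq a 0; first by rewrite !ordP0.
by have [n wn] := ord_eq_int w a0; rewrite (vE _ _ wn) m1 mul1r.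
Qed.

Lemma exists_pole_zero (K : fieldType) (v w : finitePrime K) : v <> w ->
  exists2 a, (v a < 0)%E & (0 < w a)%E.
Proof.
move=> vw; have [a va wa] := exists_pole_integral vw.
have [b wb vb] := exists_pole_integral (nesym vw).
have [n vn n0] := ord_lt0_int va; have [m wm m0] := ord_lt0_int wb.
have b0 := ord_int_neq0 wm; have a0 := ord_int_neq0 vn.
have [k vk] := ord_eq_int v b0; have [l wl] := ord_eq_int w a0.
move: vb wa; rewrite vk wl !lee_fin => k0 l0.
exists (a / b); first by rewrite (ord_intM vn (ord_intV vk)) lte_fin; lia.
by rewrite (ord_intM wl (ord_intV wm)) lte_fin; lia.
Qed.

Lemma zero_eventually (K : fieldType) (w : finitePrime K) (b c : K) : c != 0 ->
  (0 < w b)%E -> exists N, forall n, (N <= n)%N -> (0 < w (b ^+ n * c)%R)%E.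
Proof.
move=> c0 wb; have [l wc] := ord_eq_int w c0.
exists (`|l|.+1)%N => n ln.
have [->|b0] := eqVneq b 0.
  by rewrite expr0n; case: n ln => // n _; rewrite mul0r ordP0 ltey.
have [k wk] := ord_eq_int w b0; move: wb; rewrite wk lte_fin => k0.
rewrite (ord_intM (ord_intX n wk) wc) lte_fin -mulr_natr natz; nia.
Qed.

(** Induction on s.  Let b be the element for s and let c have a pole at v and a
    zero at w i.  If b is integral at w i, take b^n c.  If b has a pole at w i,
    take b^n / (1 + b^n) times c instead: the first factor is a unit at v and at
    w i.  For large n the powers of b enforce the zeros at s in both cases. *)
Lemma weak_approximation (K : fieldType) (I : eqType) (s : seq I) (v : finitePrime K)
    (w : I -> finitePrime K) : (forall i, i \in s -> v <> w i) ->
  exists2 b, (v b < 0)%E & forall i, i \in s -> (0 < w i b)%E.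
Proof.
elim: s => [|i s IH] vw.
  have [u vu] := ordP_normalized v; exists u^-1 => //.
  by rewrite (ord_intV vu) lte_fin.
have [|b vb wb] := IH; first by move=> j js; apply: vw; rewrite inE js orbT.
have [c vc wc] := exists_pole_zero (vw i (mem_head _ _)).
have [n vn n0] := ord_lt0_int vb; have [m vm m0] := ord_lt0_int vc.
have b0 := ord_int_neq0 vn; have c0 := ord_int_neq0 vm.
have [N NP] : exists N, forall j, j \in s -> (0 < w j (b ^+ N.+1 * c)%R)%E.
  have ex j : exists N, j \in s -> forall n, (N <= n)%N -> (0 < w j (b ^+ n * c)%R)%E.
    have [js|js] := boolP (j \in s); last by exists 0%N.
    by have [N NP] := zero_eventually c0 (wb j js); exists N.
  have [f fP] := choice ex; exists (\max_(j <- s) f j)%N => j js.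
  by apply: fP => //; apply: leqW; exact: leq_bigmax_seq.
have [wib|wib] := leP 0%E (w i b).
  exists (b ^+ N.+1 * c).
    by rewrite (ord_intM (ord_intX _ vn) vm) lte_fin -mulr_natr natz; nia.
  move=> j; rewrite inE => /predU1P[->|/NP //].
  by rewrite ordPM (lt_le_trans wc) // leeDr // ord_ge0X.
pose d := 1 + b ^+ N.+1.
have d_pole (u : finitePrime K) l : u b = l%:E -> l < 0 -> u d = (l *+ N.+1)%:E.
  move=> ub l0; rewrite /d addrC; apply: ord_dominant; first exact: ord_intX.
  by rewrite ordP1 lee_fin -mulr_natr natz; nia.
have [k wk k0] := ord_lt0_int wib.
exists (b ^+ N.+1 / d * c).
  rewrite (ord_intM (ord_intM (ord_intX _ vn) (ord_intV (d_pole _ _ vn n0))) vm).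
  by rewrite subrr add0r lte_fin.
move=> j; rewrite inE => /predU1P[->|js].
  rewrite ordPM (ord_intM (ord_intX _ wk) (ord_intV (d_pole _ _ wk k0))).
  by rewrite subrr add0e.
have wd : w j d = 0%E.
  apply: ord_dominant; first exact: ordP1.
  have := wb j js; have [l wl] := ord_eq_int (w j) b0.
  by rewrite wl lte_fin (ord_intX _ wl) add0r lee_fin -mulr_natr natz; nia.
by rewrite mulrAC ordPM (ord_intV wd) oppr0 adde0; exact: NP.
Qed.

(** * A function with a single pole *)

Lemma exists_last (P : nat -> Prop) B : P 0%N -> (forall n, P n -> (n <= B)%N) ->
  exists2 n, P n & ~ P n.+1.
Proof.
move=> P0 PB; apply: contrapT => no.
have allP n : P n.
  by elim: n => // n Pn; apply: contrapT => Pn'; apply: no; exists n.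
by have := PB _ (allP B.+1); rewrite ltnn.
Qed.

Lemma rmorphism_inj (D D' : nzRingType) (f : {rmorphism D -> D'}) :
  (forall x, f x = 0 -> x = 0) -> injective f.
Proof. exact: (@raddf_inj _ _ f). Qed.

Lemma mulrn_le_of_lt0 (e : int) i d : e < 0 -> (i <= d)%N -> e *+ d <= e *+ i.
Proof. by move=> e0 id_; rewrite -(subnKC id_) mulrnDr gerDl mulrn_wle0 // ltW. Qed.

Lemma mulrn_lt_of_lt0 (e : int) i d : e < 0 -> (i < d)%N -> e *+ d + 1 <= e *+ i.
Proof.
move=> e0 id_; rewrite -(subnKC id_) mulrnDr mulrSr.
have : e *+ (d - i.+1) <= 0 by rewrite mulrn_wle0 // ltW.
by move: (e *+ i) (e *+ _) => u w; lia.
Qed.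

Section Pole.
Variables (F : finFieldType) (K : fieldType) (phi : {rmorphism F -> K}).
Hypothesis dependence : forall z : K, exists B, forall a : 'I_B -> K,
  exists2 c : 'I_B -> {poly F}, exists i, c i != 0 &
    \sum_i poly_eval phi z (c i) * a i = 0.
Local Notation ev := (poly_eval phi).
Implicit Types (p : {poly F}) (z x : K).

Lemma poly_eval_coef z (p : {poly F}) n : (size p <= n)%N ->
  ev z p = \sum_(i < n) phi p`_i * z ^+ i.
Proof.
move=> pn; rewrite poly_evalE (@horner_coef_wide _ n); last first.
  by rewrite size_map_poly.
by apply: eq_bigr => i _; rewrite coef_map.
Qed.

Lemma poly_evalX z : ev z 'X = z.
Proof. by rewrite poly_evalE map_polyX hornerX. Qed.

Lemma poly_relation z : exists B, forall x, exists P : {poly {poly F}},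
  [/\ P != 0, (size P <= B.+1)%N & root (map_poly (ev z) P) x].
Proof.
have [B HB] := dependence z; exists B => x.
have [c [i ci] cE] := HB (fun i => x ^+ i).
pose P := \poly_(j < B) (if insub j is Some j' then c j' else 0).
have PE (j : 'I_B) : P`_j = c j by rewrite coef_poly ltn_ord valK.
exists P; split.
- by apply/eqP => P0; move: ci; rewrite -PE P0 coef0 eqxx.
- by apply: leqW; exact: size_poly.
apply/rootP; rewrite (@horner_coef_wide _ B); last first.
  by apply: leq_trans (size_poly _ _) _; exact: size_poly.
rewrite -[RHS]cE; apply: eq_bigr => j _; congr (_ * _).
by rewrite -PE; apply: coef_map.
Qed.

Lemma poly_eval_ge0 (v : finitePrime K) z p : (0 <= v z)%E -> (0 <= v (ev z p))%E.
Proof.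
move=> vz; rewrite (poly_eval_coef z (leqnn _)); apply: ord_ge_sum => i _.
by rewrite -[0]addr0 ord_geM ?ord_const_ge0 ?ord_ge0X.
Qed.

(** A nonzero element that vanishes at some place is transcendental over F: after
    division by a power of z, the constant term of an algebraic equation would
    be the only term of order zero. *)
Lemma poly_eval_zero_inj (v : finitePrime K) z : z != 0 -> (0 < v z)%E ->
  injective (ev z).
Proof.
move=> z0; have [k vk] := ord_eq_int v z0; rewrite vk lte_fin => k0.
apply: rmorphism_inj => p pz; apply/eqP; apply: contraT => p0.
have [n [q q0 pE]] := multiplicity_XsubC p 0.
rewrite p0 /= in q0; move: pz.
rewrite pE subr0 rmorphM rmorphXn [ev z 'X]poly_evalX => /eqP.
rewrite mulf_eq0 (negbTE (expf_neq0 _ z0)) orbF => /eqP qz.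
have : v (ev z q) = 0%E; last by rewrite qz ordP0.
rewrite (poly_eval_coef z (leqnSn _)) big_ord_recl mulr1.
apply: ord_dominant; first by rewrite ord_const // -horner_coef0.
apply: ord_ge_sum => i _; rewrite -[_ + 1]addr0 addrC ord_geM ?ord_const_ge0 //.
rewrite lift0 (ord_intX _ vk) lee_fin mulrS.
have : 0 <= k *+ i by rewrite mulrn_wge0 // ltW.
by lia.
Qed.

Section At_pole.
Variables (v : finitePrime K) (z : K) (e : int).
Hypotheses (vz : v z = e%:E) (e_lt0 : e < 0).

Lemma poly_eval_pole_ge p d : (size p <= d.+1)%N -> ((e *+ d)%:E <= v (ev z p))%E.
Proof.
move=> pd; rewrite (poly_eval_coef z pd); apply: ord_ge_sum => i _.
rewrite -[e *+ d]add0r ord_geM ?ord_const_ge0 // (ord_intX _ vz) lee_fin.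
by apply: mulrn_le_of_lt0; rewrite // -ltnS.
Qed.

Lemma poly_eval_pole p d : size p = d.+1 -> v (ev z p) = (e *+ d)%:E.
Proof.
move=> pd; rewrite (@poly_eval_coef z p d.+1) ?pd // big_ord_recr /= addrC.
apply: ord_dominant.
  rewrite ordPM (ord_intX _ vz) ord_const ?add0e //.
  by rewrite -[d]/(d.+1.-1) -pd -lead_coefE lead_coef_eq0 -size_poly_eq0 pd.
apply: ord_ge_sum => i _; rewrite -[_ + 1]add0r ord_geM ?ord_const_ge0 //.
rewrite (ord_intX _ vz) lee_fin.
exact: mulrn_lt_of_lt0.
Qed.

Lemma poly_eval_pole_inj : injective (ev z).
Proof.
apply: rmorphism_inj => p pz; apply/eqP; rewrite -size_poly_eq0; apply: contraT => p0.
have := @poly_eval_pole p (size p).-1; rewrite prednK ?lt0n // => /(_ erefl).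
by rewrite pz ordP0.
Qed.

End At_pole.
End Pole.

Section One_pole.
Variables (F : finFieldType) (K : fieldType) (phi : {rmorphism F -> K}).
Hypothesis dependence : forall z : K, exists B, forall a : 'I_B -> K,
  exists2 c : 'I_B -> {poly F}, exists i, c i != 0 &
    \sum_i poly_eval phi z (c i) * a i = 0.
Local Notation ev := (poly_eval phi).
Implicit Types (p : {poly F}) (x a b : K).
Variables (v0 : finitePrime K) (z : K).
Hypothesis v0z : v0 z = (-1)%:E.

Let ev_inj : injective (ev z) := poly_eval_pole_inj v0z (ltrN10 _).

Let z_neq0 : z != 0 := ord_int_neq0 v0z.

Definition independent n (a : 'I_n -> K) := forall c : 'I_n -> {poly F},
  \sum_i ev z (c i) * a i = 0 -> forall i, c i = 0.

Lemma independent_widen n m (nm : (n <= m)%N) (a : 'I_m -> K) :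
  independent a -> independent (a \o widen_ord nm).
Proof.
move=> ind c cE i; pose c' (j : 'I_m) := oapp c 0 (insub (val j)).
have c'E (l : 'I_n) : c' (widen_ord nm l) = c l by rewrite /c' valK.
rewrite -c'E; apply: ind; rewrite -[RHS]cE (bigID (fun j : 'I_m => (j < n)%N)) /=.
rewrite [X in _ + X]big1 ?addr0 => [|j jn]; last by rewrite /c' insubN ?rmorph0 ?mul0r.
rewrite (big_ord_narrow nm); apply: eq_bigr => l _.
by rewrite c'E.
Qed.

Lemma independent_bound : exists B, forall n (a : 'I_n -> K), independent a -> (n <= B)%N.
Proof.
have [B HB] := dependence z; exists B => n a ind; rewrite leqNgt; apply/negP => Bn.
have [c [i ci] cE] := HB (a \o widen_ord (ltnW Bn)).
by rewrite (independent_widen ind cE) eqxx in ci.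
Qed.

(** If b i has a pole at V i and zeros at the other places, then in a relation
    the term whose coefficient has the largest degree has, at the corresponding
    place, a larger pole than all the others. *)
Lemma poles_independent n (V : 'I_n -> finitePrime K) : injective V ->
  (forall i, (V i z < 0)%E) -> exists b : 'I_n -> K, independent b.
Proof.
move=> Vinj Vz.
have ex i : exists b, (V i b < 0)%E /\ forall j, j != i -> (0 < V j b)%E.
  have [|b Vb bj] := @weak_approximation K _ (seq.filter (predC1 i) (enum 'I_n)) (V i) V.
    by move=> j; rewrite mem_filter => /andP[/= /eqP ji _] /Vinj ij; apply: ji.
  by exists b; split=> // j ji; apply: bj; rewrite mem_filter /= ji mem_enum.
have [b bP] := choice ex; exists b => c cE.
pose D := (\max_i size (c i))%N.
case D0 : D => [|d].
  by move=> i; apply/eqP; rewrite -size_poly_eq0 -leqn0 -D0; exact: leq_bigmax.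
have [i ci] : exists i, size (c i) = d.+1.
  have [n0|] := posnP #|'I_n|.
    by move: D0; rewrite /D big1 // => i _; have := fintype0 i; rewrite n0.
  move=> n0; have [i] := @bigop.eq_bigmax 'I_n (fun i => size (c i)) n0.
    by rewrite -/D D0 => ci; exists i; rewrite -ci.
have [e Vie e0] := ord_lt0_int (Vz i); have [k Vib k0] := ord_lt0_int (bP i).1.
have sc j : (size (c j) <= d.+1)%N by rewrite -D0 leq_bigmax.
have : ((e *+ d)%:E <= V i (\sum_(j | j != i) ev z (c j) * b j)%R)%E.
  apply: ord_ge_sum => j ji; rewrite -[e *+ d]addr0.
  apply: ord_geM.   exact: (poly_eval_pole_ge phi Vie e0 (sc j)).
  by apply: ltW; apply: (bP j).2; rewrite eq_sym.
have -> : \sum_(j | j != i) ev z (c j) * b j = - (ev z (c i) * b i).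
  by move: cE; rewrite (bigD1 i) //= => /eqP; rewrite addrC addr_eq0 => /eqP.
rewrite ordPN (ord_intM (poly_eval_pole phi Vie e0 ci) Vib) lee_fin lerDl.
by rewrite leNgt k0.
Qed.

Lemma poles_finite : exists n (V : 'I_n -> finitePrime K),
  forall v : finitePrime K, (v z < 0)%E -> exists i, V i = v.
Proof.
have [B HB] := independent_bound.
pose P n := exists2 V : 'I_n -> finitePrime K, injective V & forall i, (V i z < 0)%E.
have [||n [V Vinj Vz] nP] := @exists_last P B.
- have [] : exists V : 'I_0 -> finitePrime K, True by exists (fun=> v0).
  by move=> V _; exists V => [i|i]; case: i => // i; rewrite ltn0.
- by move=> n [V Vinj Vz]; have [b /HB] := poles_independent Vinj Vz.
exists n, V => v vz; apply: contrapT => Vv; apply: nP.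
exists (fun i => oapp V v (unlift ord_max i)) => [i j|i].
  case: unliftP => [i' ->|->]; case: unliftP => [j' ->|->] //=.
  - by move=> /Vinj ->.
  - by move=> Viv; case: Vv; exists i'.
  - by move=> Vjv; case: Vv; exists j'.
by case: unliftP => [i' _|_] /=; first exact: Vz.
Qed.

Definition integral_at_poles a := forall v : finitePrime K, (v z < 0)%E -> (0 <= v a)%E.
Definition integral_off_v0 a := forall v : finitePrime K, (v z < 0)%E -> v <> v0 -> (0 <= v a)%E.

(** If b has a pole at v0 and zeros at the other poles of z, then b^2 / z still
    has a pole at v0, as z has a simple one, and b^2 / z times z is integral at
    the other poles. *)
Lemma exists_pole_v0 : exists b, (v0 b < 0)%E /\ integral_off_v0 (b * z).
Proof.
have [n [V VP]] := poles_finite.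
pose s := seq.filter (fun i => `[< v0 <> V i >]) (enum 'I_n).
have [|b v0b bP] := @weak_approximation K _ s v0 V.
  by move=> i; rewrite mem_filter => /andP[/asboolP].
exists (b ^+ 2 / z); split.
  have [k v0k k0] := ord_lt0_int v0b.
  by rewrite (ord_intM (ord_intX 2 v0k) (ord_intV v0z)) lte_fin; lia.
move=> v vz vv0; rewrite divfK //; apply: ord_ge0X.
have [i Vi] := VP v vz; rewrite -Vi; apply: ltW; apply: bP.
rewrite mem_filter mem_enum andbT; apply/asboolP; rewrite Vi; exact: nesym.
Qed.

(** With b as in exists_pole_v0, the element b^(j+1) / (1 + b^(j+1)) is a unit
    at v0, and at the other poles of z it has the same order as b^(j+1), which
    is divisible there by the (j+1)st power of 1/z. *)
Lemma exists_bump j : exists c, [/\ integral_at_poles c, integral_off_v0 (c * z ^+ j.+1) &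
  v0 c = 0%E].
Proof.
have [b [v0b bz]] := exists_pole_v0.
pose d := 1 + b ^+ j.+1; exists (b ^+ j.+1 / d).
have v0c : v0 (b ^+ j.+1 / d) = 0%E.
  have [k v0k k0] := ord_lt0_int v0b.
  rewrite (ord_intM (ord_intX _ v0k) (ord_intV (n := k *+ j.+1) _)) ?subrr //.
  rewrite /d addrC; apply: ord_dominant; first exact: ord_intX.
  by rewrite ordP1 lee_fin -mulr_natr natz; nia.
have vb (v : finitePrime K) : (v z < 0)%E -> v <> v0 -> (0 < v b)%E.
  move=> vz vv0; have := bz v vz vv0; rewrite ordPM; have [k -> k0] := ord_lt0_int vz.
  case: (v b) => [l||] //; rewrite ?ltey // -EFinD lee_fin lte_fin; lia.
have vd (v : finitePrime K) : (v z < 0)%E -> v <> v0 -> v d^-1 = 0%E.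
  move=> vz vv0; rewrite (@ord_intV _ _ _ 0) ?oppr0 //.
  apply: ord_dominant; first exact: ordP1.
  have := vb v vz vv0; have [->|b0] := eqVneq b 0; first by rewrite expr0n ordP0 leey.
  have [l vl] := ord_eq_int v b0.
  by rewrite vl lte_fin (ord_intX _ vl) lee_fin -mulr_natr natz; nia.
split=> // [v vz|v vz vv0].
  have [->|vv0] := pselect (v = v0); first by rewrite v0c.
  by rewrite ordPM vd // adde0 ord_ge0X // ltW // vb.
rewrite mulrAC ordPM vd // adde0 -exprMn; apply: ord_ge0X; exact: bz.
Qed.

Lemma integral_at_polesM a b :
  integral_at_poles a -> integral_at_poles b -> integral_at_poles (a * b).
Proof. by move=> ai bi v vz; rewrite ordPM adde_ge0 ?ai ?bi. Qed.

Lemma integral_at_poles_const (c : F) : integral_at_poles (phi c).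
Proof. by move=> v _; exact: ord_const_ge0. Qed.

Lemma integral_at_poles_sum (I : Type) (s : seq I) (f : I -> K) :
  (forall i, integral_at_poles (f i)) -> integral_at_poles (\sum_(i <- s) f i).
Proof. by move=> fi v vz; apply: ord_ge_sum => i _; exact: fi. Qed.

Lemma integral_off_v0D a b :
  integral_off_v0 a -> integral_off_v0 b -> integral_off_v0 (a + b).
Proof. by move=> ai bi v vz vv0; apply: ord_geD; [exact: ai|exact: bi]. Qed.

Lemma integral_at_poles_off_v0 a : integral_at_poles a -> integral_off_v0 a.
Proof. by move=> ai v vz _; exact: ai. Qed.

Lemma integral_at_poles_poly p d : (size p <= d)%N ->
  integral_at_poles (ev z p * z / z ^+ d).
Proof.
move=> pd v vz; have [e ve e0] := ord_lt0_int vz.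
case: d pd => [|d pd].
  by rewrite leqn0 size_poly_eq0 => /eqP ->; rewrite rmorph0 !mul0r ordP0 leey.
rewrite ordPM (ord_intV (ord_intX _ ve)) ordPM ve.
have := poly_eval_pole_ge phi ve e0 pd; case: (v (ev z p)) => [l||] //.
by rewrite -!EFinD !lee_fin => le; rewrite mulrS; move: (e *+ d) le => u; lia.
Qed.

(** With y = 1/z, this is independence over F in the ring of elements integral
    at the poles of z, modulo y; a lies in the ideal of y when a * z is
    integral. *)
Definition independent_mod n (b : 'I_n -> K) := (forall i, integral_at_poles (b i)) /\
  forall c : 'I_n -> F, integral_at_poles ((\sum_i phi (c i) * b i) * z) ->
  forall i, c i = 0.

(** In a relation with polynomial coefficients in z, divide by the largest power
    z^d that occurs: modulo y only the coefficients of z^d remain, and they form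
    a nontrivial relation over F. *)
Lemma independent_mod_independent n (b : 'I_n -> K) : independent_mod b -> independent b.
Proof.
move=> [bi bind] c cE.
pose D := (\max_i size (c i))%N.
have sc j : (size (c j) <= D)%N by exact: leq_bigmax.
case D0 : D => [|d]; first by move=> i; apply/eqP; rewrite -size_poly_eq0 -leqn0 -D0.
have lead0 : forall i, (c i)`_d = 0.
  apply: (bind (fun i => (c i)`_d)).
  pose low i := c i - ((c i)`_d)%:P * 'X^d.
  have slow i : (size (low i) <= d)%N.
    apply/leq_sizeP => j dj; rewrite coefB coefCM coefXn.
    have [->|jd] := eqVneq j d; first by rewrite mulr1 subrr.
    rewrite mulr0 subr0 nth_default // (leq_trans (sc i)) // D0.
    by rewrite ltn_neqAle eq_sym jd.
  have -> : (\sum_i phi (c i)`_d * b i) * z =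
      - \sum_i (ev z (low i) * z / z ^+ d) * b i.
    have cE' i : phi (c i)`_d = (ev z (c i) - ev z (low i)) / z ^+ d.
      rewrite /low rmorphB opprB addrC subrK rmorphM rmorphXn [ev z 'X]poly_evalX.
      by rewrite mulfK ?expf_neq0 // poly_evalE map_polyC hornerC.
    rewrite -sumrN mulr_suml; apply/eqP; rewrite -subr_eq0 -sumrB.
    rewrite (eq_bigr (fun i => z / z ^+ d * (ev z (c i) * b i))) => [|i _].
      by rewrite -mulr_sumr cE mulr0.
    rewrite cE' opprK; ring.
  move=> v vz; rewrite ordPN; move: v vz; apply: integral_at_poles_sum => i.
  by apply: integral_at_polesM => //; exact: integral_at_poles_poly.
exfalso; have : (D <= d)%N.
  apply/bigmax_leqP => i _; apply/leq_sizeP => j dj.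
  have [->|jd] := eqVneq j d; first exact: lead0.
  by rewrite nth_default // (leq_trans (sc i)) // D0 ltn_neqAle eq_sym jd.
by rewrite D0 ltnn.
Qed.

(** The quotient by y has dimension at most N over F.  A maximal independent
    family starting with the bump c is a basis of it, and multiples of c
    contribute only elements h integral off v0 after multiplication by z^(j+1);
    so the coordinate along c needs no representatives, which saves a factor
    #|F|. *)
Lemma residue_representatives N j :
  (forall n (b : 'I_n -> K), independent b -> (n <= N)%N) ->
  exists2 s : seq K, (size s <= #|F| ^ N.-1)%N & forall a, integral_at_poles a ->
    exists2 r, r \in s & exists2 h, integral_off_v0 (h * z ^+ j.+1) &
      integral_at_poles ((a - r - h) * z).
Proof.
move=> HN; have [c [ci cz v0c]] := exists_bump j.
pose P n := exists2 b : 'I_n.+1 -> K, independent_mod b & b ord0 = c.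
have [||n [b bind b0] nP] := @exists_last P N.
- exists (fun=> c) => //; split=> [//|al alP i]; rewrite (ord1 i).
  apply/eqP; apply: contraT => al0.
  have := alP v0; rewrite v0z lte_fin ltrN10 => /(_ isT); rewrite big_ord1.
  by rewrite !ordPM v0z v0c ord_const // !add0e lee_fin lerN10.
- by move=> n [b /independent_mod_independent/HN/ltnW bn _].
have nN : (n <= N.-1)%N.
  have := HN _ _ (independent_mod_independent bind); by case: (N).
exists [seq \sum_(i < n) phi (be i) * b (lift ord0 i) | be : {ffun 'I_n -> F}].
  by rewrite size_map -cardE card_ffun card_ord leq_pexp2l // ltnW // card_finNzRing_gt1.
move=> a ai.
pose b' (i : 'I_n.+2) := oapp b a (unlift ord_max i).
have b'w (i : 'I_n.+1) : b' (widen_ord (leqnSn _) i) = b i.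
  have -> : widen_ord (leqnSn _) i = lift ord_max i by apply: val_inj; exact: esym (lift_max i).
  by rewrite /b' liftK.
have b'm : b' ord_max = a by rewrite /b' unlift_none.
have [al [alP [i0 al0]]] : exists al : 'I_n.+2 -> F,
    integral_at_poles ((\sum_i phi (al i) * b' i) * z) /\ exists i, al i != 0.
  apply: contrapT => none; apply: nP; exists b'; last first.
    by rewrite -b0 -b'w; congr b'; exact: val_inj.
  split=> [i|al alP i]; first by rewrite /b'; case: unliftP => [i' _|_] //=; apply: bind.1.
  by apply/eqP; apply: contraT => ali; case: none; exists al; split=> //; exists i.
rewrite big_ord_recr /= b'm in alP.
have sumE : \sum_(i < n.+1) phi (al (widen_ord (leqnSn _) i)) * b' (widen_ord (leqnSn _) i) =
    \sum_(i < n.+1) phi (al (widen_ord (leqnSn _) i)) * b i.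
  by apply: eq_bigr => i _; rewrite b'w.
rewrite sumE in alP.
have alm : al ord_max != 0.
  apply/eqP => alm; rewrite alm rmorph0 mul0r addr0 in alP.
  have al_w := bind.2 (fun i => al (widen_ord (leqnSn _) i)) alP.
  move/eqP: al0; apply; case: (unliftP ord_max i0) => [i ->|-> //].
  by rewrite -(al_w i); congr al; apply: val_inj; exact: lift_max i.
pose be i := - (al (widen_ord (leqnSn _) i) / al ord_max).
exists (\sum_(i < n) phi (be (lift ord0 i)) * b (lift ord0 i)).
  apply/mapP; exists [ffun i => be (lift ord0 i)]; first by rewrite mem_enum.
  by apply: eq_bigr => i _; rewrite ffunE.
exists (phi (be ord0) * c).
  move=> v vz vv0; rewrite -mulrA ordPM adde_ge0 ?ord_const_ge0 //; exact: cz.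
have -> : a - \sum_(i < n) phi (be (lift ord0 i)) * b (lift ord0 i) - phi (be ord0) * c =
    phi (al ord_max)^-1 *
    (\sum_(i < n.+1) phi (al (widen_ord (leqnSn _) i)) * b i + phi (al ord_max) * a).
  have hE : \sum_(i < n.+1) phi (be i) * b i =
      phi (be ord0) * c + \sum_(i < n) phi (be (lift ord0 i)) * b (lift ord0 i).
    by rewrite big_ord_recl b0.
  rewrite -addrA -opprD [X in a - X]addrC -hE [RHS]mulrDr [X in _ = _ + X]mulrA.
  rewrite -rmorphM mulVf // rmorph1 mul1r [RHS]addrC; congr (a + _).
  rewrite mulr_sumr -sumrN; apply: eq_bigr => i _.
  by rewrite -mulNr -rmorphN /be opprK [RHS]mulrA -rmorphM [_^-1 * _]mulrC.
by rewrite -mulrA; apply: integral_at_polesM => //; exact: integral_at_poles_const.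
Qed.

(** The polar part of order j+1 is removed, up to elements of the ring integral
    off v0, by a representative of its leading coefficient; what is left has
    poles of order at most j relative to z. *)
Lemma pole_representatives N j :
  (forall n (b : 'I_n -> K), independent b -> (n <= N)%N) ->
  exists2 s : seq K, (size s <= #|F| ^ (N.-1 * j))%N &
    forall a, integral_at_poles (a / z ^+ j) -> exists2 r, r \in s & integral_off_v0 (a - r).
Proof.
move=> HN; elim: j => [|j [s ss sP]].
  exists [:: 0]; first by rewrite muln0.
  move=> a; rewrite expr0 divr1 => ai; exists 0; first by rewrite mem_head.
  by rewrite subr0; exact: integral_at_poles_off_v0.
have [s' ss' s'P] := residue_representatives j HN.
exists [seq r' * z ^+ j.+1 + r | r' <- s', r <- s].
  by rewrite size_allpairs mulnS expnD leq_mul.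
move=> a /s'P[r' r's [h hz ai]].
have [|r rs ar] := sP (a - (r' + h) * z ^+ j.+1).
  move: ai; congr integral_at_poles.
  have zj : z ^+ j != 0 by rewrite expf_neq0.
  by rewrite exprS; move: (z ^+ j) zj => u u0; field; rewrite u0 z_neq0.
exists (r' * z ^+ j.+1 + r); first by apply/allpairsP; exists (r', r).
have -> : a - (r' * z ^+ j.+1 + r) = (a - (r' + h) * z ^+ j.+1 - r) + h * z ^+ j.+1 by ring.
exact: integral_off_v0D.
Qed.

Lemma integral_at_poles_Vz n : integral_at_poles (z^-1 ^+ n).
Proof.
move=> v vz; have [e ve e0] := ord_lt0_int vz; apply: ord_ge0X.
by rewrite (ord_intV ve) lee_fin oppr_ge0 ltW.
Qed.

(** If l is the leading coefficient of an equation for x, then l x satisfies a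
    monic equation over F[z].  At the poles of z, division by z^C turns the
    coefficients of that equation into integral elements when C bounds their
    sizes. *)
Lemma integral_multiple x : exists p C, [/\ p != 0,
  forall v : finitePrime K, (0 <= v z)%E -> (0 <= v (ev z p * x)%R)%E &
  integral_at_poles (ev z p * x / z ^+ C)].
Proof.
have [B HB] := poly_relation dependence z; have [P [P0 _ /rootP Px]] := HB x.
case sP : (size P) => [|[|D]].
- by move/eqP: sP; rewrite size_poly_eq0 (negbTE P0).
- exfalso; have /size_poly1P[l l0 Pl] : size P == 1%N by rewrite sP.
  move: Px; rewrite Pl map_polyC hornerC -[RHS](rmorph0 (ev z)) => /ev_inj/eqP.
  by rewrite (negbTE l0).
pose l := P`_D.+1; have l0 : l != 0.
  by rewrite /l -[D.+1]/(D.+2.-1) -sP -lead_coefE lead_coef_eq0.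
pose y := ev z l * x; pose e (i : 'I_D.+1) := - P`_i * l ^+ (D - i).
have yE : y ^+ D.+1 = \sum_(i < D.+1) ev z (e i) * y ^+ i.
  have : ev z l * x ^+ D.+1 = - \sum_(i < D.+1) ev z P`_i * x ^+ i.
    have coefP i : (map_poly (ev z) P)`_i = ev z P`_i by exact: coef_map.
    apply/eqP; rewrite -addr_eq0 addrC; apply/eqP; rewrite -[RHS]Px.
    rewrite (@horner_coef_wide _ D.+2); last by rewrite (leq_trans (size_poly _ _)) // sP.
    rewrite [RHS]big_ord_recr /= coefP; congr (_ + _).
    by apply: eq_bigr => i _; rewrite coefP.
  move=> lx; have -> : y ^+ D.+1 = ev z l ^+ D * (ev z l * x ^+ D.+1).
    by rewrite /y exprMn exprS mulrA [ev z l * _]mulrC -exprSr.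
  rewrite lx mulrN -mulNr mulr_sumr; apply: eq_bigr => i _.
  rewrite /e /y exprMn rmorphM rmorphN rmorphXn.
  have -> : ev z l ^+ D = ev z l ^+ (D - i) * ev z l ^+ i.
    by rewrite -exprD subnK // -ltnS.
  ring.
pose C := (\max_i size (e i))%N; exists l, C; split=> // [v vz|v vz].
  by apply: (ord_ge0_monic_root _ yE) => i; exact: poly_eval_ge0.
have zC : z ^+ C != 0 by rewrite expf_neq0.
pose e' (i : 'I_D.+1) := ev z (e i) / z ^+ C * z^-1 ^+ (C * (D - i)).
apply: (@ord_ge0_monic_root _ v D.+1 _ e').
  move=> i; suff ei : integral_at_poles (e' i) by exact: ei.
  apply: integral_at_polesM (integral_at_poles_Vz _).
  have ei : (size (e i) <= C.+1)%N by rewrite leqW // leq_bigmax.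
  have := integral_at_poles_poly ei; congr integral_at_poles.
  by rewrite exprS; field; rewrite zC z_neq0.
rewrite expr_div_n yE mulr_suml; apply: eq_bigr => i _.
have -> : (z ^+ C) ^+ D.+1 = z ^+ C * z ^+ (C * (D - i)) * (z ^+ C) ^+ i.
  rewrite -!exprM -!exprD; congr (z ^+ _).
  by rewrite -mulnS -mulnDr addSn subnK // -ltnS.
rewrite /e' exprVn expr_div_n.
have zi : (z ^+ C) ^+ i != 0 by rewrite !expf_neq0.
have zD : z ^+ (C * (D - i)) != 0 by rewrite expf_neq0.
move: zC zi zD; move: ((z ^+ C) ^+ i) (z ^+ (C * _)) (z ^+ C) (y ^+ i) => u1 u2 u3 u4 *.
by field; apply/and3P.
Qed.

(** A family of maximal size N, scaled to be integral over F[z]. *)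
Lemma exists_integral_family : exists N (a : 'I_N -> K) C,
  [/\ (0 < N)%N, independent a,
      forall n (b : 'I_n -> K), independent b -> (n <= N)%N,
      forall i (v : finitePrime K), (0 <= v z)%E -> (0 <= v (a i))%E &
      forall i, integral_at_poles (a i / z ^+ C)].
Proof.
have [B HB] := independent_bound.
pose P n := exists a : 'I_n -> K, independent a.
have [||N [a aind] nP] := @exists_last P B.
- by exists (fun=> 0) => c _ [].  
- by move=> n [b /HB].
have HN n (b : 'I_n -> K) : independent b -> (n <= N)%N.
  move=> bind; rewrite leqNgt; apply/negP => Nn; apply: nP.
  by exists (b \o widen_ord Nn); exact: independent_widen.
have N0 : (0 < N)%N.
  apply: (HN 1%N (fun=> 1)) => c; rewrite big_ord1 mulr1 -(rmorph0 (ev z)) => /ev_inj c0 i.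
  by rewrite (ord1 i).
have mex i := integral_multiple (a i).
have [p pP] := choice mex; have [C CP] := choice pP.
exists N, (fun i => ev z (p i) * a i), (\max_i C i)%N; split=> //.
- move=> c cE i; have [pi0 _ _] := CP i; apply/eqP; rewrite -(mulrI_eq0 _ (mulfI pi0)).
  apply/eqP; rewrite mulrC; apply: (aind (fun i => c i * p i)); rewrite -[RHS]cE.
  by apply: eq_bigr => j _; rewrite rmorphM mulrA.
- by move=> i; case: (CP i).
move=> i; have [_ _] := CP i.
have Ci : (C i <= \max_i C i)%N by exact: leq_bigmax.
rewrite -(subnKC Ci) exprD invfM mulrA => ai.
by apply: integral_at_polesM => //; rewrite -exprVn; exact: integral_at_poles_Vz.
Qed.

(** The factor z in w makes the difference vanish at the zeros of z, which will
    show that it is not constant.  The choice n = N C gives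
    (N-1) (n + 1 + C) < N (n + 1), so that there are more elements w c than
    classes modulo the elements integral off v0. *)
Lemma exists_one_pole : exists t, [/\ t != 0, forall v, v <> v0 -> (0 <= v t)%E &
  forall v : finitePrime K, (0 < v z)%E -> (0 < v t)%E].
Proof.
have [N [a [C [N0 aind HN a_fin a_inf]]]] := exists_integral_family.
pose n := (N * C)%N.
have [s ss sP] := pole_representatives (n.+1 + C) HN.
pose sum (c : 'I_N -> {poly F}) := \sum_i ev z (c i) * a i.
pose X : finType := {ffun 'I_N -> {poly_n.+1 F}}.
pose w (c : X) := z * sum (fun i => val (c i)).
have w_int (c : X) : integral_at_poles (w c / z ^+ (n.+1 + C)).
  have -> : w c / z ^+ (n.+1 + C) =
      \sum_i (ev z (val (c i)) * z / z ^+ n.+1) * (a i / z ^+ C).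
    rewrite /w /sum mulr_sumr mulr_suml; apply: eq_bigr => i _.
    by rewrite exprD invfM; move: (z ^+ n.+1)^-1 (z ^+ C)^-1 => u1 u2; ring.
  apply: integral_at_poles_sum => i; apply: integral_at_polesM (a_inf i).
  apply: integral_at_poles_poly; exact: size_npoly.
have gex (c : X) : exists l : 'I_(size s), integral_off_v0 (w c - s`_l).
  have [r rs wr] := sP _ (w_int c).
  have rl : (index r s < size s)%N by rewrite index_mem.
  by exists (Ordinal rl); rewrite /= nth_index.
have [g gP] := choice gex.
have /injectivePn[c [c' cc' gcc']] : ~~ injectiveb g.
  apply/negP => /injectiveP/leq_card; rewrite card_ord card_ffun card_npoly card_ord.
  move=> /leq_trans/(_ ss); rewrite -expnM leq_exp2l ?card_finNzRing_gt1 //.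
  by rewrite leqNgt /n; case: (N) N0 => // N' _ /negP; apply; rewrite /=; nia.
have tE : w c - w c' = z * sum (fun i => val (c i) - val (c' i)).
  rewrite /w /sum -mulrBr -sumrB; congr (_ * _); apply: eq_bigr => i _.
  by rewrite rmorphB mulrBl.
have sum_fin (v : finitePrime K) : (0 <= v z)%E ->
    (0 <= v (sum (fun i => val (c i) - val (c' i))%R))%E.
  move=> vz; apply: ord_ge_sum => i _; rewrite ordPM adde_ge0 ?a_fin //.
  exact: poly_eval_ge0.
exists (w c - w c'); split=> [|v vv0|v vz].
- rewrite tE mulf_neq0 //; apply: contraNneq cc' => sum0.
  apply/eqP/ffunP => i; apply: val_inj; apply/eqP; rewrite -subr_eq0.
  by rewrite (aind _ sum0 i).
- have [vz|vz] := leP 0%E (v z); first by rewrite tE ordPM adde_ge0 // sum_fin.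
  have -> : w c - w c' = (w c - s`_(g c)) + (s`_(g c') - w c') by rewrite gcc'; ring.
  apply: ord_geD; first exact: (gP c v).
  by rewrite -opprB ordPN; exact: (gP c' v).
- by rewrite tE ordPM (lt_le_trans vz) // leeDl // sum_fin // ltW.
Qed.

End One_pole.

(** * Function fields *)

(** The image of the natural numbers is finite in positive characteristic. *)
Lemma no_archimedean_pchar (R : realType) (K : fieldType) p :
  p \in [pchar K] -> archimedeanPrime R K -> False.
Proof.
move=> pK [_ [v [[v_ge0 _ _ _] v_arch] _]].
have [n] := v_arch (\sum_(i < p) v i%:R).
apply/negP; rewrite -leNgt -(GRing.natr_mod_pchar pK) //.
have np : (n %% p < p)%N by rewrite ltn_mod prime_gt0 // (GRing.pcharf_prime pK).
by rewrite (bigD1 (Ordinal np)) //= lerDl sumr_ge0.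
Qed.

Lemma power_sumX_inj (F : fieldType) n :
  injective (fun D : {set 'I_n} => \sum_(i in D) ('X : {poly F}) ^+ i).
Proof.
have coefE (D : {set 'I_n}) (j : 'I_n) : (\sum_(i in D) ('X : {poly F}) ^+ i)`_j = (j \in D)%:R.
  rewrite coef_sum; have [jD|jD] := boolP (j \in D).
    rewrite (bigD1 j) //= coefXn eqxx big1 ?addr0 // => i /andP[_ ij].
    by rewrite coefXn (inj_eq val_inj) eq_sym (negbTE ij).
  rewrite big1 // => i iD; rewrite coefXn (inj_eq val_inj).
  by case: eqP => // ji; rewrite ji iD in jD.
move=> D D' /polyP DD'; apply/setP => j; have := DD' j; rewrite !coefE.
by case: (j \in D); case: (j \in D') => // /eqP; rewrite ?oner_eq0 // eq_sym oner_eq0.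
Qed.

(** The function t with no pole outside v0 is transcendental, as it vanishes at
    some place: a place above the prime z of F[z].  It then plays the role of
    the variable, the primes being irreducible polynomials in t of growing
    degree. *)
Lemma function_field_permutation_chain (R : realType) (F : finFieldType)
    (K : fieldExtType {fraction {poly F}}) (S : set (primeOf R K)) (v0 : finitePrime K) k m :
  finite_set S -> S (Defs.Finite R v0) ->
  exists r : 'I_m.+1 -> SInteger S, infinite_set [set P : SInteger S -> bool |
    nonzero_prime_ideal P /\ permutation_residue_chain k.+1 P r].
Proof.
move=> Sfin Sv0; pose phi := const_embedding K.
have dep := @function_field_dependence F K.
have [u v0u] := ordP_normalized v0; pose z := u^-1.
have v0z : v0 z = (-1)%:E by exact: ord_intV.
have [t [t0 t_off tz]] := exists_one_pole dep v0z.
have [v vz] : exists v : finitePrime K, (0 < v z)%E.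
  have Xirr : irreducible_poly ('X : {poly F}) by rewrite -['X]subr0; exact: irredp_XsubC.
  have [pi piX _] := poly_prime_residue Xirr (monicX F).
  have [B HB] := poly_relation dep z.
  have ev_inj := poly_eval_pole_inj (phi := phi) v0z (ltrN10 _).
  have [v [_ vX _]] := exists_finitePrime_above pi ev_inj HB.
  by exists v; rewrite piX poly_evalX in vX.
have ev_inj := poly_eval_zero_inj (phi := phi) t0 (tz v vz).
have [B HB] := poly_relation dep t.
have evS a : poly_eval phi t a \in Sint S.
  apply/asboolP => P SP; apply: poly_eval_ge0; apply: t_off => Pv0.
  by apply: SP; rewrite Pv0.
have piex n : exists P : prime_residue {poly F}, forall a : {poly F}, a != 0 ->
    (size a <= n)%N -> residue P a != 0.
  have [h [hirr hmon nh]] := exists_large_irreducible F n.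
  have [P _ resP] := poly_prime_residue hirr hmon.
  exists P => a a0 an; rewrite resP; apply/negP => /(dvdp_leq a0).
  by rewrite leqNgt (leq_ltn_trans an).
have [pi piP] := choice piex.
apply: (@exists_permutation_chain R K S Sfin {poly F} (poly_eval phi t) B ev_inj HB evS
  pi _ 'X (@power_sumX_inj F)).
by move=> a a0; exists (size a) => j aj; exact: piP.
Qed.

Theorem corollary1p4 (R : realType) (K : globalField)
  (S : set (primeOf R K)) (Sfin : finite_set S)
  (Sarch : is_number_field K ->
     forall w : archimedeanPrime R K, S (Archimedean w))
  (* For a function field and S empty, A is the finite field of constants and
     has no nonzero prime ideal. *)
  (Sne : is_function_field K -> S !=set0)
  (k m : nat) (k_gt0 : (0 < k)%N) (m_gt0 : (0 < m)%N) :
  exists r : 'I_m -> SInteger S,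
    infinite_set [set P : SInteger S -> bool |
      nonzero_prime_ideal P /\ permutation_residue_chain k P r].
Proof.
case: k m k_gt0 m_gt0 => // k [//|m] _ _.
case: K S Sfin Sarch Sne => [K|F K] S Sfin Sarch Sne.
  exact: number_field_permutation_chain.
have [[v0|w] Sv0] := Sne isT; first exact: function_field_permutation_chain Sv0.
have [p _ pF] := finPcharP F.
have pK : p \in [pchar K] by apply: (rmorph_pchar (const_embedding K)).
by case: (no_archimedean_pchar pK w).
Qed.
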